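(* Let $\Gamma$ be a finite simplicial graph which is connected, triangle-free and has at least two edges. If $\Gamma$ is not a star, the subgroup $G$ of $Out(A_\Gamma)$ generated by the images of $A$, $L$ and $C$ is free abelian of rank $$2|V\setminus V_0|+\sum_{v\in V_0}(\delta_C(v)-\tau(v)-1).$$
   Context: $V$ is the vertex set of $\Gamma$ and $A_\Gamma=\langle V \mid vw=wv \text{ if } v,w \text{ are adjacent}\rangle$. $lk(v)$ is the set of neighbours of $v$; $\Gamma$ is a star if some vertex is adjacent to all others and $\Gamma$ is spanned by these edges. A leaf is a vertex of valence one. Vertices with the same link are equivalent; $v\le w$ (and $[v]\le[w]$) if $lk(v)\subseteq lk(w)$. $V_0$ consists of one chosen vertex from each maximal equivalence class. The subgroups $A,L,C$ of $Aut(A_\Gamma)$: - For each vertex $v\in V\setminus V_0$ choose a vertex $w\in V_0$ with $v\le w$; $A$ is generated by all the corresponding left and right transvections $v\mapsto wv$ and $v\mapsto vw$ (other generators fixed). - $L$ is generated by the leaf transvections $u\mapsto uv$, where $u$ is a leaf and $v$ its unique neighbour (other generators fixed). - $C$ is generated by the automorphisms which, for a vertex $v$ and a connected component of $\Gamma-\{v\}$, conjugate by $v$ all generators in that component and fix the other generators. $\delta_C(v)$ is the number of connected components of $\Gamma-\{v\}$. A component of $\Gamma-\{v\}$ is a leaf component if it contains only one vertex; it is a twig if it is not a leaf component but is contained in the ball of radius 2 about $v$ in the geometric realization of $\Gamma$ with unit edge lengths (equivalently, all its vertices are at distance at most 2 from $v$ and no two of its vertices at distance exactly 2 from $v$ are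 adjacent). $\tau(v)$ is the number of twigs at $v$. *)

(* Defs.v *)
From HB Require Import structures.
From mathcomp Require Import all_boot all_order all_algebra.
From mathcomp Require Import boolp classical_sets.

Set Implicit Arguments.
Unset Strict Implicit.
Unset Printing Implicit Defensive.

(* A finite simplicial graph is a relation e on a finType V; its symmetry and
   irreflexivity are assumed where needed rather than bundled. *)

Section Graphs.
Variables (V : finType) (e : rel V).
Implicit Types (v w x y : V) (D : {set V}).

Definition connected_graph := forall x y, connect e x y.

Definition triangle_free := forall x y z, e x y -> e y z -> ~~ e x z.

Definition edges : {set {set V}} := [set [set p.1; p.2] | p : V * V & e p.1 p.2].

Definition is_star :=
  exists v, (forall w, w != v -> e v w) /\
            (forall x y, e x y -> x = v \/ y = v).

Definition lk v : {set V} := [set w | e v w].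

Definition is_leaf v := #|lk v| == 1.

Definition vle v w := lk v \subset lk w.
Definition vequiv : rel V := fun v w => lk v == lk w.
Definition vmaximal v := [forall w, vle v w ==> vle w v].

Definition maximal_vertices : {set V} := [set v | vmaximal v].
Definition maximal_classes : {set {set V}} :=
  equivalence_partition vequiv maximal_vertices.

Definition is_V0 (V0 : {set V}) :=
  is_transversal V0 maximal_classes maximal_vertices.

Definition walk (n : nat) x y :=
  [exists p : n.-tuple V, path e x p && (last x p == y)].

(* Combinatorial distance; vertices in different components get #|V|. *)
Definition gdist x y : nat := find (fun n => walk n x y) (iota 0 #|V|).

(* Isolates v; the other components are those of the graph minus v. *)
Definition del v : rel V := fun x y => [&& x != v, y != v & e x y].

Definition components v : {set {set V}} :=
  equivalence_partition (connect (del v)) [set~ v].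

Definition delta_C v : nat := #|components v|.

Definition leaf_component D := #|D| == 1.

(* The second and third conjuncts say that D lies in the ball of radius 2 about
   v in the geometric realization: the midpoint of an edge joining two vertices
   at distance 2 from v is at distance 5/2. *)
Definition twig v D :=
  [&& ~~ leaf_component D,
      [forall x in D, gdist v x <= 2] &
      [forall x in D, forall y in D,
         (gdist v x == 2) && (gdist v y == 2) ==> ~~ e x y]].

Definition tau v : nat := #|[set D in components v | twig v D]|.

End Graphs.

Local Open Scope quotient_scope.
Local Open Scope group_scope.

Section Subgroups.
Variable G : groupType.
Implicit Types (H S : set G).

Definition is_subgroup H :=
  [/\ H 1, (forall x y, H x -> H y -> H (x * y)) & (forall x, H x -> H x^-1)].

Definition generated S : set G := smallest is_subgroup S.

Definition free_abelian_of_rank H (n : nat) :=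
  exists phi : 'rV[int]_n -> G,
    [/\ {morph phi : a b / (a + b)%R >-> a * b}, injective phi & range phi = H].

End Subgroups.

Section Raag.
Variables (V : finType) (e : rel V).

(* The letter (v, true) stands for v and (v, false) for its inverse. *)
Definition word := seq (V * bool).

(* The smallest congruence on words containing the relations of A_Gamma. *)
Inductive raag_eq : word -> word -> Prop :=
| raag_refl s : raag_eq s s
| raag_sym s t : raag_eq s t -> raag_eq t s
| raag_trans s t u : raag_eq s t -> raag_eq t u -> raag_eq s u
| raag_cat s s' t t' : raag_eq s s' -> raag_eq t t' -> raag_eq (s ++ t) (s' ++ t')
| raag_cancel v b : raag_eq [:: (v, b); (v, ~~ b)] [::]
| raag_comm v w :
    e v w -> raag_eq [:: (v, true); (w, true)] [:: (w, true); (v, true)].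

Definition raag_rel : rel word := fun s t => `[< raag_eq s t >].

Lemma raag_rel_refl : reflexive raag_rel.
Proof. by move=> s; apply/asboolP; apply: raag_refl. Qed.

Lemma raag_rel_sym : symmetric raag_rel.
Proof. by move=> s t; apply/asboolP/asboolP; apply: raag_sym. Qed.

Lemma raag_rel_trans : transitive raag_rel.
Proof.
move=> t s u /asboolP st /asboolP tu.
by apply/asboolP; apply: raag_trans st tu.
Qed.

Canonical raag_equiv :=
  EquivRel raag_rel raag_rel_refl raag_rel_sym raag_rel_trans.

Definition raag := {eq_quot raag_equiv}.

HB.instance Definition _ := Choice.on raag.
HB.instance Definition _ := EqQuotient.on raag.

Definition winv (s : word) : word := rev [seq (l.1, ~~ l.2) | l <- s].

Definition of_word (s : word) : raag := \pi s.
Definition word_of (g : raag) : word := repr g.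

Lemma word_ofK : cancel word_of of_word.
Proof. by move=> g; apply: reprK. Qed.

Lemma raag_eqP (s t : word) : raag_eq s t <-> of_word s = of_word t.
Proof.
by split=> [h|/eqmodP/asboolP //]; apply/eqmodP/asboolP.
Qed.

Lemma raag_eq_repr (s : word) : raag_eq (word_of (of_word s)) s.
Proof. by apply/raag_eqP; exact: word_ofK. Qed.

Lemma winv_cat s t : winv (s ++ t) = winv t ++ winv s.
Proof. by rewrite /winv map_cat rev_cat. Qed.

Lemma winvK : involutive winv.
Proof.
move=> s; rewrite /winv map_rev revK -map_comp -[RHS]map_id.
by apply: eq_map => -[v b] /=; rewrite negbK.
Qed.

Lemma raag_winvr (s : word) : raag_eq (s ++ winv s) [::].
Proof.
elim: s => [|[v b] s ihs]; first exact: raag_refl.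
have -> : winv ((v, b) :: s) = winv s ++ [:: (v, ~~ b)].
  by rewrite -cat1s winv_cat.
have -> : ((v, b) :: s) ++ winv s ++ [:: (v, ~~ b)] =
    [:: (v, b)] ++ (s ++ winv s) ++ [:: (v, ~~ b)] by rewrite /= -catA.
apply: raag_trans (raag_cancel v b); apply: (raag_cat (raag_refl [:: (v, b)])).
exact: (raag_cat ihs (raag_refl [:: (v, ~~ b)])).
Qed.

Lemma raag_winvl (s : word) : raag_eq (winv s ++ s) [::].
Proof. by rewrite -{2}[s]winvK; apply: raag_winvr. Qed.

Lemma raag_eq_winv (s t : word) : raag_eq s t -> raag_eq (winv s) (winv t).
Proof.
move=> st; apply: (@raag_trans _ (winv s ++ (t ++ winv t))).
  rewrite -[X in raag_eq X _]cats0; apply: raag_cat (raag_refl _) _.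
  exact/raag_sym/raag_winvr.
rewrite catA -[X in raag_eq _ X]cat0s; apply: raag_cat (raag_refl _).
apply: raag_trans (raag_winvl s); apply: raag_cat (raag_refl _) _.
exact: raag_sym.
Qed.

Definition raag_mul (g h : raag) : raag := of_word (word_of g ++ word_of h).
Definition raag_one : raag := of_word [::].
Definition raag_inv (g : raag) : raag := of_word (winv (word_of g)).

Lemma raag_mul_pi s t : raag_mul (of_word s) (of_word t) = of_word (s ++ t).
Proof. by apply/raag_eqP/raag_cat; apply: raag_eq_repr. Qed.

Lemma raag_inv_pi s : raag_inv (of_word s) = of_word (winv s).
Proof. by apply/raag_eqP/raag_eq_winv/raag_eq_repr. Qed.

Lemma raag_mulA : associative raag_mul.
Proof.
move=> x y z; rewrite -[x]word_ofK -[y]word_ofK -[z]word_ofK.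
by rewrite !raag_mul_pi catA.
Qed.

Lemma raag_mul1 : left_id raag_one raag_mul.
Proof. by move=> x; rewrite -[x]word_ofK raag_mul_pi. Qed.

Lemma raag_mulr1 : right_id raag_one raag_mul.
Proof. by move=> x; rewrite -[x]word_ofK raag_mul_pi cats0. Qed.

Lemma raag_mulV : left_inverse raag_one raag_inv raag_mul.
Proof.
move=> x; rewrite -[x]word_ofK raag_inv_pi raag_mul_pi.
exact/raag_eqP/raag_winvl.
Qed.

Lemma raag_mulrV : right_inverse raag_one raag_inv raag_mul.
Proof.
move=> x; rewrite -[x]word_ofK raag_inv_pi raag_mul_pi.
exact/raag_eqP/raag_winvr.
Qed.

HB.instance Definition _ := isGroup.Build raag
  raag_mulA raag_mul1 raag_mulr1 raag_mulV raag_mulrV.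

Definition gen (v : V) : raag := of_word [:: (v, true)].

End Raag.

Section Automorphisms.
Variable G : groupType.

Record aut := Aut_ {
  aut_fun :> G -> G;
  aut_finv : G -> G;
  aut_funM : {morph aut_fun : x y / x * y};
  aut_funK : cancel aut_fun aut_finv;
  aut_finvK : cancel aut_finv aut_fun }.

HB.instance Definition _ := gen_eqMixin aut.
HB.instance Definition _ := gen_choiceMixin aut.

Lemma autP (f g : aut) : f =1 g -> f = g.
Proof.
case: f g => [f f' fM fK f'K] [g g' gM gK g'K] /= fg.
have {}fg : f = g by apply/funext.
subst g; have fg' : f' = g' by apply/funext => x; rewrite -[x in LHS]g'K fK.
by subst g'; congr Aut_; apply: Prop_irrelevance.
Qed.

Lemma aut_finvM (f : aut) : {morph aut_finv f : x y / x * y}.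
Proof. by move=> x y; apply: (can_inj (aut_funK f)); rewrite aut_funM !aut_finvK. Qed.

Lemma aut_fun1 (f : aut) : f 1 = 1.
Proof. by apply: (mulgI (f 1)); rewrite -aut_funM !mulg1. Qed.

Definition aut_one : aut :=
  @Aut_ id id (fun _ _ => erefl) (fun _ => erefl) (fun _ => erefl).

Definition aut_inv (f : aut) : aut :=
  Aut_ (aut_finvM f) (aut_finvK f) (aut_funK f).

Lemma aut_compM (f g : aut) : {morph f \o g : x y / x * y}.
Proof. by move=> x y /=; rewrite !aut_funM. Qed.

(* (f * g) x = f (g x) *)
Definition aut_mul (f g : aut) : aut :=
  Aut_ (@aut_compM f g) (can_comp (aut_funK f) (aut_funK g))
    (can_comp (aut_finvK g) (aut_finvK f)).

Lemma aut_mulA : associative aut_mul.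
Proof. by move=> f g h; apply: autP. Qed.

Lemma aut_mul1 : left_id aut_one aut_mul.
Proof. by move=> f; apply: autP. Qed.

Lemma aut_mulr1 : right_id aut_one aut_mul.
Proof. by move=> f; apply: autP. Qed.

Lemma aut_mulV : left_inverse aut_one aut_inv aut_mul.
Proof. by move=> f; apply: autP => x /=; rewrite aut_funK. Qed.

Lemma aut_mulrV : right_inverse aut_one aut_inv aut_mul.
Proof. by move=> f; apply: autP => x /=; rewrite aut_finvK. Qed.

HB.instance Definition _ := isGroup.Build aut
  aut_mulA aut_mul1 aut_mulr1 aut_mulV aut_mulrV.

Lemma inner_funM (g : G) : {morph conjg^~ g : x y / x * y}.
Proof. by move=> x y; rewrite conjMg. Qed.

(* Recall that x ^ g = g^-1 * (x * g). *)
Definition inner (g : G) : aut :=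
  Aut_ (@inner_funM g) (conjgK g) (conjgKV g).

Definition out_rel : rel aut := fun f h => `[< exists g : G, f = inner g * h >].

Lemma innerM (g h : G) : inner g * inner h = inner (h * g).
Proof. by apply: autP => x /=; rewrite conjgM. Qed.

Lemma inner1 : inner 1 = 1.
Proof. by apply: autP => x /=; rewrite conjg1. Qed.

Lemma aut_inner (f : aut) (g : G) : f * inner g = inner (f g) * f.
Proof.
apply: autP => x /=; rewrite !conjgE !aut_funM; congr (_ * _).
by apply: (mulIg (f g)); rewrite -aut_funM !mulVg aut_fun1.
Qed.

Lemma out_rel_refl : reflexive out_rel.
Proof. by move=> f; apply/asboolP; exists 1; rewrite inner1 mul1g. Qed.

Lemma out_rel_symW f h : out_rel f h -> out_rel h f.
Proof.
case/asboolP=> g ->; apply/asboolP; exists g^-1.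
by rewrite mulgA innerM mulgV inner1 mul1g.
Qed.

Lemma out_rel_sym : symmetric out_rel.
Proof. by move=> f h; apply/idP/idP; apply: out_rel_symW. Qed.

Lemma out_rel_trans : transitive out_rel.
Proof.
move=> h f k /asboolP[a ->] /asboolP[b ->].
by apply/asboolP; exists (b * a); rewrite mulgA innerM.
Qed.

Canonical out_equiv := EquivRel out_rel out_rel_refl out_rel_sym out_rel_trans.

Definition out := {eq_quot out_equiv}.

HB.instance Definition _ := Choice.on out.
HB.instance Definition _ := EqQuotient.on out.

Definition to_out (f : aut) : out := \pi_out f.

Definition out_lift (x : out) : aut := repr x.

Lemma out_liftK : cancel out_lift to_out.
Proof. by move=> x; apply: reprK. Qed.

Lemma to_outP (f h : aut) : (exists g, f = inner g * h) <-> to_out f = to_out h.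
Proof. by split=> [k|/eqmodP/asboolP //]; apply/eqmodP/asboolP. Qed.

Lemma out_repr (f : aut) : exists g, out_lift (to_out f) = inner g * f.
Proof. by apply/to_outP; exact: out_liftK. Qed.

Definition out_mul (x y : out) : out := to_out (out_lift x * out_lift y).
Definition out_one : out := to_out 1.
Definition out_inv (x : out) : out := to_out (out_lift x)^-1.

Lemma out_mul_pi f h : out_mul (to_out f) (to_out h) = to_out (f * h).
Proof.
have [[a fa] [b hb]] := (out_repr f, out_repr h).
rewrite /out_mul fa hb; apply/to_outP; exists (f b * a).
by rewrite -innerM -!mulgA; congr (_ * _); rewrite mulgA aut_inner mulgA.
Qed.

Lemma out_inv_pi f : out_inv (to_out f) = to_out f^-1.
Proof.
have [a fa] := out_repr f.
rewrite /out_inv fa invgM; apply/to_outP; exists (f^-1 a^-1).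
rewrite -aut_inner; congr (_ * _); apply: (mulgI (inner a)).
by rewrite mulgV innerM mulVg inner1.
Qed.

Lemma out_mulA : associative out_mul.
Proof.
move=> x y z; rewrite -[x]out_liftK -[y]out_liftK -[z]out_liftK.
by rewrite !out_mul_pi mulgA.
Qed.

Lemma out_mul1 : left_id out_one out_mul.
Proof. by move=> x; rewrite -[x]out_liftK out_mul_pi mul1g. Qed.

Lemma out_mulr1 : right_id out_one out_mul.
Proof. by move=> x; rewrite -[x]out_liftK out_mul_pi mulg1. Qed.

Lemma out_mulV : left_inverse out_one out_inv out_mul.
Proof.
by move=> x; rewrite -[x]out_liftK out_inv_pi out_mul_pi mulVg.
Qed.

Lemma out_mulrV : right_inverse out_one out_inv out_mul.
Proof.
by move=> x; rewrite -[x]out_liftK out_inv_pi out_mul_pi mulgV.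
Qed.

HB.instance Definition _ := isGroup.Build out
  out_mulA out_mul1 out_mulr1 out_mulV out_mulrV.

End Automorphisms.

Section Subgroups_of_Aut.
Variables (V : finType) (e : rel V).
Local Notation gen := (gen e).
Implicit Types f : aut (raag e).

Local Open Scope classical_set_scope.

Definition left_transvection v w f :=
  f (gen v) = gen w * gen v /\ forall u, u != v -> f (gen u) = gen u.

Definition right_transvection v w f :=
  f (gen v) = gen v * gen w /\ forall u, u != v -> f (gen u) = gen u.

Definition partial_conjugation v (D : {set V}) f :=
  forall u, f (gen u) = if u \in D then gen v * gen u * (gen v)^-1 else gen u.

(* c v is the vertex of V0 chosen for v outside V0. *)
Definition A_subgroup (V0 : {set V}) (c : V -> V) : set (aut (raag e)) :=
  generated [set f | exists v, v \notin V0 /\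
    (left_transvection v (c v) f \/ right_transvection v (c v) f)].

Definition L_subgroup : set (aut (raag e)) :=
  generated [set f | exists u v,
    [/\ is_leaf e u, v \in lk e u & right_transvection u v f]].

Definition C_subgroup : set (aut (raag e)) :=
  generated [set f | exists v D,
    D \in components e v /\ partial_conjugation v D f].

Definition G_subgroup (V0 : {set V}) (c : V -> V) : set (out (raag e)) :=
  generated (@to_out (raag e) @` (A_subgroup V0 c `|` L_subgroup `|` C_subgroup)).

End Subgroups_of_Aut.

Arguments A_subgroup {V} e V0 c _.
Arguments L_subgroup {V} e _.
Arguments C_subgroup {V} e _.
Arguments G_subgroup {V} e V0 c _.

(* Main.v *)
Require Import Defs.
From HB Require Import structures.
From mathcomp Require Import all_boot all_order all_algebra zify ring.
From mathcomp Require Import boolp classical_sets.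

(** Every generator is local to some vertex v of V0: it sends each generator x
    to v^a x v^b with exponents a, b depending on x.  A leaf has its neighbour
    in V0, partial conjugations by a vertex outside V0 are inner, and the
    vertices at distance 2 from v in a twig at v are vertices u with
    c u = v, so a partial conjugation of a twig is a product of transvections.
    Local automorphisms at v commute; those at distinct v, w in V0 commute up to
    inner automorphisms by powers of v and w, after which their supports are
    disjoint, because a third vertex is joined to w in the complement of v or to
    v in the complement of w.

    It follows that G is the image of a homomorphism Phi from Z^T to
    Out(A_Gamma), where T consists of the 2|V \ V0| transvections and, for v in
    V0, of the components at v which are not twigs.  For each v in V0 the product
    of all conjugations by v is inner, and this is one relation with coefficients
    0, 1, -1.  There is no other: if a product of generators is inner, it acts
    trivially on the abelianization, and for nonadjacent v and x the quotient of
    A_Gamma onto the integral Heisenberg group sending v and x to the standard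
    generators detects the exponent of v with which x is conjugated; this
    exponent must be independent of x.  Each relation has a coefficient 1, so it
    removes one generator from T. *)

Set Implicit Arguments.
Unset Strict Implicit.
Unset Printing Implicit Defensive.

Import GRing.Theory.
Local Open Scope group_scope.

(** The delta functions generate the group of integer functions on a finite type. This reduces a
    claim about a homomorphism on exponent functions to a claim about single generators. *)
Lemma int_fun_ind (T : finType) (P : (T -> int) -> Prop) :
  P (fun=> 0%R) -> (forall n n', P n -> P n' -> P (fun t => n t + n' t)%R) ->
  (forall n, P n -> P (fun t => - n t)%R) ->
  (forall t, P (fun s => (s == t)%:Z)%R) -> forall n, P n.
Proof.
move=> P0 PD PN P1 n.
have PZ t (z : int) : P (fun s => z * (s == t)%:Z)%R.
  have PX (k : nat) : P (fun s => k%:Z * (s == t)%:Z)%R.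
    elim: k => [|k ih].
      have -> : (fun s => 0%:Z * (s == t)%:Z)%R = (fun=> 0%R) :> (T -> int).
        by apply/funext => s; rewrite mul0r.
      exact: P0.
    have -> : (fun s => k.+1%:Z * (s == t)%:Z)%R =
        (fun s => k%:Z * (s == t)%:Z + (s == t)%:Z)%R.
      by apply/funext => s; rewrite -addn1 PoszD mulrDl mul1r.
    exact: PD.
  case: z => k; first exact: PX.
  have -> : (fun s => Negz k * (s == t)%:Z)%R =
      (fun s => - (k.+1%:Z * (s == t)%:Z))%R.
    by apply/funext => s; rewrite NegzE mulNr.
  exact: PN.
(* Induction on a list outside which [n] is truncated to 0. *)
suff H (s : seq T) : P (fun t => if t \in s then n t else 0%R).
  by have := H (enum T); congr P; apply/funext => t; rewrite mem_enum.
elim: s => [|t0 s ih]; first by [].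
have [ts|ts] := boolP (t0 \in s).
  congr P: ih; apply/funext => t; rewrite inE.
  by case: eqVneq => [->|//]; rewrite ts.
have -> : (fun t => if t \in t0 :: s then n t else 0%R) =
    (fun t => n t0 * (t == t0)%:Z + (if t \in s then n t else 0))%R.
  apply/funext => t; rewrite inE; case: eqVneq => [->|_] /=.
    by rewrite (negPf ts) mulr1 addr0.
  by rewrite mulr0 add0r.
exact: PD.
Qed.

(** * Integer powers and group morphisms *)

Section IntPowers.
Variable G : groupType.
Implicit Types (x y : G) (a b : int).

Definition zexp x a := match a with Posz n => x ^+ n | Negz n => x ^- n.+1 end.

Lemma zexp0 x : zexp x 0 = 1. Proof. by []. Qed.

Lemma zexpS x a : zexp x (a + 1)%R = zexp x a * x.
Proof.
case: a => [n|[|n]].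
- have -> : (Posz n + 1 = Posz n.+1)%R by lia.
  by rewrite /zexp expgSr.
- by rewrite /= mulVg.
- have -> : (Negz n.+1 + 1 = Negz n)%R by lia.
  by rewrite /zexp [in RHS]expgS invgM -mulgA mulVg mulg1.
Qed.

Lemma zexpB1 x a : zexp x (a - 1)%R = zexp x a * x^-1.
Proof. by rewrite -[in RHS](subrK 1%R a) zexpS mulgK. Qed.

Lemma zexpD x a b : zexp x (a + b)%R = zexp x a * zexp x b.
Proof.
elim/int_ind: b => [|n ih|n ih]; first by rewrite addr0 zexp0 mulg1.
- have -> : Posz n.+1 = (n%:Z + 1)%R by lia.
  by rewrite addrA !zexpS ih mulgA.
- have -> : (- Posz n.+1 = - n%:Z - 1)%R by lia.
  by rewrite addrA !zexpB1 ih mulgA.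
Qed.

Lemma zexpN x a : zexp x (- a)%R = (zexp x a)^-1.
Proof. by apply: (mulgI (zexp x a)); rewrite -zexpD subrr mulgV. Qed.

Lemma commute_zexp x y a : commute x y -> commute x (zexp y a).
Proof.
by case: a => n xy; [exact: commuteX | apply: commuteV; exact: commuteX].
Qed.

Lemma commute_zexp2 x y a b : commute x y -> commute (zexp x a) (zexp y b).
Proof. by move=> xy; apply/commute_zexp/commute_sym/commute_zexp/commute_sym. Qed.

End IntPowers.

Section Morphisms.
Variables (G H : groupType) (f : G -> H).
Hypothesis fM : {morph f : x y / x * y}.

Lemma morph1 : f 1 = 1.
Proof. by apply: (mulgI (f 1)); rewrite -fM !mulg1. Qed.

Lemma morphV x : f x^-1 = (f x)^-1.
Proof. by apply: (mulgI (f x)); rewrite -fM !mulgV morph1. Qed.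

Lemma morph_zexp x a : f (zexp x a) = zexp (f x) a.
Proof.
have fX n : f (x ^+ n) = f x ^+ n.
  by elim: n => [|n ih]; rewrite ?morph1 // !expgS fM ih.
by case: a => n /=; rewrite ?morphV fX.
Qed.

Lemma morph_prod (I : Type) (s : seq I) (P : pred I) (F : I -> G) :
  f (\prod_(i <- s | P i) F i) = \prod_(i <- s | P i) f (F i).
Proof. exact: (big_morph f fM morph1). Qed.

End Morphisms.

(** * The universal property of the right-angled Artin group *)

Section UniversalProperty.
Variables (V : finType) (e : rel V) (H : groupType).
Implicit Types (h : V -> H) (s t : seq (V * bool)).

Definition word_eval h s : H :=
  foldr (fun l x => (if l.2 then h l.1 else (h l.1)^-1) * x) 1 s.

Lemma word_eval_cat h s t : word_eval h (s ++ t) = word_eval h s * word_eval h t.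
Proof. by elim: s => [|l s ih] /=; rewrite ?mul1g // ih mulgA. Qed.

Definition edge_commute h := forall v w, e v w -> commute (h v) (h w).

Lemma word_eval_eq h s t :
  edge_commute h -> raag_eq e s t -> word_eval h s = word_eval h t.
Proof.
move=> hC; elim=> {s t} [//|//|s t u _ -> _ -> //|s s' t t' _ es _ et|v b|v w vw].
- by rewrite !word_eval_cat es et.
- by case: b => /=; rewrite mulg1 ?mulgV ?mulVg.
- by rewrite /= !mulg1; apply: hC.
Qed.

Definition raag_lift h (x : raag e) : H := word_eval h (word_of x).

Lemma raag_liftE h s : edge_commute h -> raag_lift h (of_word e s) = word_eval h s.
Proof. by move=> hC; apply: word_eval_eq => //; apply: raag_eq_repr. Qed.

Lemma raag_lift_gen h v : edge_commute h -> raag_lift h (gen e v) = h v.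
Proof. by move=> hC; rewrite raag_liftE //= mulg1. Qed.

Lemma raag_liftM h : edge_commute h -> {morph raag_lift h : x y / x * y}.
Proof.
move=> hC x y; rewrite -[x]word_ofK -[y]word_ofK.
rewrite [_ * _]raag_mul_pi !raag_liftE //; exact: word_eval_cat.
Qed.

Lemma gen_invE v : (gen e v)^-1 = of_word e [:: (v, false)].
Proof. by rewrite [LHS]raag_inv_pi. Qed.

Lemma raag_ind (P : raag e -> Prop) :
  P 1 -> (forall v x, P x -> P (gen e v * x)) ->
  (forall v x, P x -> P ((gen e v)^-1 * x)) -> forall x, P x.
Proof.
move=> P1 Pg PV x; rewrite -[x]word_ofK; elim: (word_of x) => [|[v b] s ih] //.
have -> : of_word e ((v, b) :: s) = of_word e [:: (v, b)] * of_word e s.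
  by rewrite [RHS]raag_mul_pi.
by case: b; [exact: Pg | rewrite -gen_invE; exact: PV].
Qed.

Lemma raag_morph_eq (f g : raag e -> H) :
  {morph f : x y / x * y} -> {morph g : x y / x * y} ->
  (forall v, f (gen e v) = g (gen e v)) -> f =1 g.
Proof.
move=> fM gM fg; elim/raag_ind => [|v x ih|v x ih].
- by rewrite !morph1.
- by rewrite fM gM fg ih.
- by rewrite fM gM !morphV // fg ih.
Qed.

Lemma gen_commute v w : e v w -> commute (gen e v) (gen e w).
Proof.
move=> vw; rewrite /commute [LHS]raag_mul_pi [RHS]raag_mul_pi.
exact/raag_eqP/raag_comm.
Qed.

End UniversalProperty.

Lemma raag_aut_eq (V : finType) (e : rel V) (f g : aut (raag e)) :
  (forall v, f (gen e v) = g (gen e v)) -> f = g.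
Proof.
move=> fg; apply: autP; apply: raag_morph_eq => //; exact: aut_funM.
Qed.

(** * The integral Heisenberg group *)

(* (p, q, r) stands for the unitriangular matrix [[1,p,r],[0,1,q],[0,0,1]]. *)
Definition heis := (int * int * int)%type.

HB.instance Definition _ := Choice.on heis.

Section Heisenberg.
Implicit Types x y : heis.
Local Open Scope ring_scope.

Definition heis_mul x y : heis :=
  (x.1.1 + y.1.1, x.1.2 + y.1.2, x.2 + y.2 + x.1.1 * y.1.2).
Definition heis_one : heis := (0, 0, 0).
Definition heis_inv x : heis := (- x.1.1, - x.1.2, x.1.1 * x.1.2 - x.2).

Lemma heis_mulA : associative heis_mul.
Proof.
move=> [[a b] c] [[a' b'] c'] [[a'' b''] c'']; rewrite /heis_mul /=.
by congr (_, _, _); ring.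
Qed.

Lemma heis_mul1 : left_id heis_one heis_mul.
Proof. by move=> [[a b] c]; rewrite /heis_mul /=; congr (_, _, _); ring. Qed.

Lemma heis_mulr1 : right_id heis_one heis_mul.
Proof. by move=> [[a b] c]; rewrite /heis_mul /=; congr (_, _, _); ring. Qed.

Lemma heis_mulV : left_inverse heis_one heis_inv heis_mul.
Proof.
by move=> [[a b] c]; rewrite /heis_mul /heis_inv /=; congr (_, _, _); ring.
Qed.

Lemma heis_mulrV : right_inverse heis_one heis_inv heis_mul.
Proof.
by move=> [[a b] c]; rewrite /heis_mul /heis_inv /=; congr (_, _, _); ring.
Qed.

End Heisenberg.

HB.instance Definition _ := isGroup.Build heis
  heis_mulA heis_mul1 heis_mulr1 heis_mulV heis_mulrV.

(** * Generated subgroups *)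

Section GeneratedSubgroups.
Variable G : groupType.
Implicit Types H S : set G.
Local Open Scope classical_set_scope.

Lemma generated_subgroup S : is_subgroup (generated S).
Proof.
split=> [H [[H1 _ _] _] //|x y xS yS H HS|x xS H HS].
- by have [_ HM _] := HS.1; apply: HM; [exact: xS | exact: yS].
- by have [_ _ HV] := HS.1; apply: HV; exact: xS.
Qed.

Lemma sub_generated S : S `<=` generated S.
Proof. by move=> x xS H [_]; apply. Qed.

Lemma generated_min S H : is_subgroup H -> S `<=` H -> generated S `<=` H.
Proof. by move=> sH SH x; apply. Qed.

End GeneratedSubgroups.

(** * Automorphisms that multiply generators by powers of one vertex *)

Section LocalAutomorphisms.
Variables (V : finType) (e : rel V).
Hypotheses (e_sym : symmetric e) (e_irr : irreflexive e).
Local Notation gen := (gen e).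
Implicit Types (f g : aut (raag e)) (u v w x y : V) (m p : V -> int).

(** Vanishing exponents at [v] make [f] fix [gen v], so that exponents add under composition. *)
Definition is_local v m m' f :=
  [/\ m v = 0%R, m' v = 0%R &
      forall x, f (gen x) = zexp (gen v) (m x) * gen x * zexp (gen v) (m' x)].

(** This makes the images of adjacent generators commute: either both are conjugated by the same
    power of [v], or one of them is adjacent to [v] and only conjugated, hence fixed, and it
    commutes with the powers of [v] around the other. *)
Definition local_admissible v m m' :=
  [/\ m v = 0%R, m' v = 0%R & forall x y, x != v -> y != v -> e x y ->
    [\/ [/\ m x = m y, m' x = (- m x)%R & m' y = (- m y)%R],
        e v x /\ m' x = (- m x)%R | e v y /\ m' y = (- m y)%R]].

Lemma conj_zexp_id v x a b : e v x -> b = (- a)%R ->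
  zexp (gen v) a * gen x * zexp (gen v) b = gen x.
Proof.
move=> vx ->; rewrite zexpN (commute_sym (commute_zexp a _)) ?mulgK //.
exact/commute_sym/gen_commute.
Qed.

Lemma local_admissible_commute v m m' : local_admissible v m m' ->
  edge_commute e (fun x => zexp (gen v) (m x) * gen x * zexp (gen v) (m' x)).
Proof.
move=> [mv m'v adm].
have vC y a b : e v y ->
    commute (gen v) (zexp (gen v) a * gen y * zexp (gen v) b).
  move=> vy; apply: commuteM; last exact: commute_zexp.
  by apply: commuteM; [exact: commute_zexp | exact: gen_commute].
have nbrC x y : e v y -> e x y ->
    commute (gen y) (zexp (gen v) (m x) * gen x * zexp (gen v) (m' x)).
  move=> vy xy; have yv : commute (gen y) (gen v).
    exact/commute_sym/gen_commute.
  apply: commuteM; last exact: commute_zexp.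
  by apply: commuteM; [exact: commute_zexp | apply: gen_commute; rewrite e_sym].
move=> x y xy; have [xv|xv] := eqVneq x v.
  by rewrite xv mv m'v mul1g mulg1; apply: vC; rewrite -xv.
have [yv|yv] := eqVneq y v.
  rewrite yv mv m'v mul1g mulg1; apply/commute_sym/vC.
  by rewrite e_sym -yv.
case: (adm x y xv yv xy) => [[exy -> ->]|[vx ex]|[vy ey]].
- rewrite -exy zexpN; set z := zexp _ _.
  have := gen_commute xy; rewrite /commute => C.
  by rewrite -!mulgA !mulKg (mulgA (gen x)) (mulgA (gen y)) C.
- by rewrite (conj_zexp_id vx ex); apply: nbrC => //; rewrite e_sym.
- by rewrite (conj_zexp_id vy ey); apply/commute_sym/nbrC.
Qed.

Lemma local_admissibleN v m m' : local_admissible v m m' ->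
  local_admissible v (fun x => - m x)%R (fun x => - m' x)%R.
Proof.
move=> [mv m'v adm]; split=> [||x y xv yv xy]; rewrite ?mv ?m'v ?oppr0 //.
case: (adm x y xv yv xy) => [[-> -> ->]|[vx ex]|[vy ey]].
- by constructor 1.
- by constructor 2; rewrite ex.
- by constructor 3; rewrite ey.
Qed.

(** The negated exponents are admissible too, and as both maps fix [gen v], they are inverse to each
    other. *)
Lemma local_exists v m m' : local_admissible v m m' ->
  exists f, is_local v m m' f.
Proof.
move=> adm; have admN := local_admissibleN adm.
have [mv m'v _] := adm.
pose h (k k' : V -> int) x := zexp (gen v) (k x) * gen x * zexp (gen v) (k' x).
have hC := local_admissible_commute adm.
have hNC := local_admissible_commute admN.
(* Stated for any two opposite pairs of exponents, so that it yields both cancellations. *)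
have hK k k' l l' : edge_commute e (h k k') -> edge_commute e (h l l') ->
    k v = 0%R -> k' v = 0%R -> (forall x, l x = - k x)%R ->
    (forall x, l' x = - k' x)%R ->
    cancel (raag_lift (h l l')) (raag_lift (h k k')).
  move=> kC lC kv k'v lE l'E.
  have kM := raag_liftM kC; have lM := raag_liftM lC.
  have fv : raag_lift (h k k') (gen v) = gen v.
    by rewrite raag_lift_gen // /h kv k'v mul1g mulg1.
  suff : raag_lift (h k k') \o raag_lift (h l l') =1 id by [].
  apply: raag_morph_eq => [x y /=|//|x /=]; first by rewrite lM kM.
  rewrite raag_lift_gen // /h !kM !(morph_zexp kM) -/(h k k') fv.
  rewrite raag_lift_gen // /h lE l'E !zexpN.
  by rewrite -!mulgA mulKg mulgV mulg1.
exists (Aut_ (raag_liftM hC)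
  (hK _ _ _ _ hNC hC (esym (esym (etrans (congr1 _ mv) (oppr0 _))))
      (etrans (congr1 _ m'v) (oppr0 _))
      (fun x => esym (opprK _)) (fun x => esym (opprK _)))
  (hK _ _ _ _ hC hNC mv m'v (fun=> erefl) (fun=> erefl))).
by split=> // x /=; rewrite raag_lift_gen.
Qed.

Lemma local_zexp v m m' f a : is_local v m m' f ->
  f (zexp (gen v) a) = zexp (gen v) a.
Proof.
move=> [mv m'v fE]; rewrite (morph_zexp (aut_funM f)).
by rewrite fE mv m'v mul1g mulg1.
Qed.

Lemma local_mul v m m' p p' f g : is_local v m m' f -> is_local v p p' g ->
  is_local v (fun x => m x + p x)%R (fun x => m' x + p' x)%R (f * g).
Proof.
move=> fL gL; have [mv m'v fE] := fL; have [pv p'v gE] := gL.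
split=> [||x]; rewrite ?mv ?m'v ?pv ?p'v //.
rewrite -[LHS]/(f (g (gen x))) gE !aut_funM !(local_zexp _ fL) fE.
by rewrite [in RHS]addrC !zexpD !mulgA.
Qed.

(** If [x] is adjacent to [v], powers of [gen v] pass through [gen x] and only their total matters.
    This freedom absorbs conjugations of leaf components. *)
Lemma local_uniq v m m' p p' f g : is_local v m m' f -> is_local v p p' g ->
  (forall x, x != v -> m x = p x /\ m' x = p' x \/
     [/\ e v x & (m x + m' x = p x + p' x)%R]) -> f = g.
Proof.
move=> [mv m'v fE] [pv p'v gE] mp; apply: raag_aut_eq => x; rewrite fE gE.
have [->|xv] := eqVneq x v; first by rewrite mv m'v pv p'v.
case: (mp x xv) => [[-> ->] //|[vx E]].
have C a : commute (zexp (gen v) a) (gen x).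
  exact/commute_sym/commute_zexp/commute_sym/gen_commute.
by rewrite !C -!mulgA -!zexpD E.
Qed.

Definition constant_off v (k : int) x : int := if x == v then 0%R else k.

(** As [x ^ g] is [g^-1 * x * g], conjugating by the power [- k] puts the exponent [k] on the
    left. *)
Lemma inner_local v k :
  is_local v (constant_off v k) (constant_off v (- k)%R)
    (inner (zexp (gen v) (- k)%R)).
Proof.
rewrite /constant_off; split; rewrite ?eqxx // => x /=.
rewrite conjgE -zexpN opprK mulgA; case: eqVneq => [->|//].
rewrite -mulgA (commute_zexp _ (commute_refl (gen v))) mulgA -zexpD subrr.
by rewrite mulg1.
Qed.

(** Since [v] and [w] commute, [f] fixes [gen w] and [g] fixes [gen v]; both composites then
    surround [gen x] by commuting powers of [v] and [w]. *)
Lemma local_commute_nbr v w m m' p p' f g : e v w ->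
  is_local v m m' f -> is_local w p p' g ->
  m' w = (- m w)%R -> p' v = (- p v)%R -> f * g = g * f.
Proof.
move=> vw fL gL mw pv; have [_ _ fE] := fL; have [_ _ gE] := gL.
have fw a : f (zexp (gen w) a) = zexp (gen w) a.
  by rewrite (morph_zexp (aut_funM f)) fE conj_zexp_id.
have gv a : g (zexp (gen v) a) = zexp (gen v) a.
  by rewrite (morph_zexp (aut_funM g)) gE conj_zexp_id // e_sym.
have C a b : commute (zexp (gen v) a) (zexp (gen w) b).
  exact/commute_zexp2/gen_commute.
apply: raag_aut_eq => x.
rewrite -[LHS]/(f (g (gen x))) -[RHS]/(g (f (gen x))) fE gE !aut_funM fE gE fw gv.
by rewrite fw gv -!mulgA C !mulgA C.
Qed.

Lemma local_commute_disjoint v w m m' p p' f g :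
  is_local v m m' f -> is_local w p p' g ->
  m w = 0%R -> m' w = 0%R -> p v = 0%R -> p' v = 0%R ->
  (forall x, m x = 0%R /\ m' x = 0%R \/ p x = 0%R /\ p' x = 0%R) ->
  f * g = g * f.
Proof.
move=> fL gL mw m'w pv p'v mp; have [_ _ fE] := fL; have [_ _ gE] := gL.
have fw a : f (zexp (gen w) a) = zexp (gen w) a.
  by rewrite (morph_zexp (aut_funM f)) fE mw m'w mul1g mulg1.
have gv a : g (zexp (gen v) a) = zexp (gen v) a.
  by rewrite (morph_zexp (aut_funM g)) gE pv p'v mul1g mulg1.
apply: raag_aut_eq => x.
rewrite -[LHS]/(f (g (gen x))) -[RHS]/(g (f (gen x))) fE gE !aut_funM fE gE !fw !gv.
by case: (mp x) => -[-> ->]; rewrite !mul1g !mulg1.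
Qed.

Lemma to_outM f g : to_out (f * g) = to_out f * to_out g.
Proof. by rewrite [RHS]out_mul_pi. Qed.

Lemma to_out_inner (a : raag e) : to_out (inner a) = 1.
Proof. by apply/to_outP; exists a; rewrite mulg1. Qed.

(* Up to the inner automorphisms by powers of [v] and [w], one may assume that
   [f] fixes [w] and [g] fixes [v]; then [f] and [g] have disjoint supports. *)
Lemma local_commute_out v w m m' p p' f g : v != w ->
  is_local v m m' f -> is_local w p p' g ->
  m' w = (- m w)%R -> p' v = (- p v)%R ->
  (forall x, x != v -> x != w ->
    m x = m w /\ m' x = (- m w)%R \/ p x = p v /\ p' x = (- p v)%R) ->
  commute (to_out f) (to_out g).
Proof.
move=> vw fL gL mw pv mp.
have f'L := local_mul (inner_local v (- m w)%R) fL.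
have g'L := local_mul (inner_local w (- p v)%R) gL.
have := local_commute_disjoint f'L g'L.
have [mv m'v _] := fL; have [pw p'w _] := gL.
rewrite /constant_off eq_sym (negPf vw) !opprK mw pv !addNr !subrr.
move=> /(_ erefl erefl erefl erefl) fg.
rewrite /commute -!to_outM.
have E (a : raag e) h : to_out h = to_out (inner a * h).
  by rewrite to_outM to_out_inner mul1g.
have EM (a b : raag e) h k :
    to_out (h * k) = to_out (inner a * h * (inner b * k)).
  by rewrite to_outM (E a h) (E b k) [RHS]to_outM.
rewrite (EM (zexp (gen v) (m w)) (zexp (gen w) (p v)) f g).
rewrite (EM (zexp (gen w) (p v)) (zexp (gen v) (m w)) g f).
rewrite fg // => x; have [->|xv] := eqVneq x v.
  by left; rewrite mv m'v.
have [->|xw] := eqVneq x w; first by right; rewrite pw p'w.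
by case: (mp x xv xw) => -[-> ->]; [left | right]; rewrite addNr subrr.
Qed.

End LocalAutomorphisms.

(** * Detecting exponents of conjugators *)

Section Invariants.
Variables (V : finType) (e : rel V).
Hypotheses (e_sym : symmetric e) (e_irr : irreflexive e).
Local Notation gen := (gen e).
Implicit Types (f g : aut (raag e)) (u v w : V) (x y : raag e).

Definition heis_gen v w u : heis := ((u == v)%:Z, (u == w)%:Z, 0)%R.

Definition to_heis v w : raag e -> heis := raag_lift (heis_gen v w).

(** The exponent sum of the letter [v]. Taking both vertices equal to [v] is allowed since [e] has
    no loops, and the first coordinate is additive. *)
Definition exponent v x : int := (to_heis v v x).1.1.

Lemma heis_mulE (a b : heis) :
  a * b = (a.1.1 + b.1.1, a.1.2 + b.1.2, a.2 + b.2 + a.1.1 * b.1.2)%R.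
Proof. by []. Qed.

Lemma heis_invE (a : heis) :
  a^-1 = (- a.1.1, - a.1.2, a.1.1 * a.1.2 - a.2)%R.
Proof. by []. Qed.

(** Central coordinates of the two products can differ only if one of [a], [b] is [v] and the other
    is [w], which an edge [e a b] excludes. *)
Lemma heis_gen_commute v w : ~~ e v w -> edge_commute e (heis_gen v w).
Proof.
move=> vw a b ab; rewrite /commute !heis_mulE /=; congr (_, _, _).
- by rewrite addrC.
- by rewrite addrC.
have vw' : ~~ e w v by rewrite e_sym.
case: (eqVneq a v) (eqVneq b w) (eqVneq a w) (eqVneq b v)
  => [?|_] [?|_] [?|_] [?|_]; subst; rewrite ?mulr0 ?mul0r //;
  by rewrite ?ab in vw vw'.
Qed.

Lemma to_heisM v w : ~~ e v w -> {morph to_heis v w : x y / x * y}.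
Proof. by move=> vw; apply/raag_liftM/heis_gen_commute. Qed.

Lemma to_heis_gen v w u : ~~ e v w -> to_heis v w (gen u) = heis_gen v w u.
Proof. by move=> vw; apply/raag_lift_gen/heis_gen_commute. Qed.

Let intb : ((false%:Z = 0 :> int)%R * (true%:Z = 1 :> int)%R)%type.
Proof. by []. Qed.

Let loopless v : ~~ e v v. Proof. by rewrite e_irr. Qed.

Lemma exponentM v x y : exponent v (x * y) = (exponent v x + exponent v y)%R.
Proof. by rewrite /exponent to_heisM. Qed.

Lemma exponent1 v : exponent v 1 = 0%R.
Proof. by apply: (addrI (exponent v 1)); rewrite -exponentM mulg1 addr0. Qed.

Lemma exponentV v x : exponent v x^-1 = (- exponent v x)%R.
Proof.
by apply: (addrI (exponent v x)); rewrite -exponentM mulgV subrr exponent1.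
Qed.

Lemma exponent_gen v u : exponent v (gen u) = (u == v)%:Z%R.
Proof. by rewrite /exponent to_heis_gen. Qed.

Lemma exponent_zexp v x a : exponent v (zexp x a) = (exponent v x * a)%R.
Proof.
elim/int_ind: a => [|n ih|n ih]; first by rewrite zexp0 exponent1 mulr0.
- have -> : Posz n.+1 = (n%:Z + 1)%R by lia.
  by rewrite zexpS exponentM ih mulrDr mulr1.
- have -> : (- Posz n.+1 = - n%:Z - 1)%R by lia.
  by rewrite zexpB1 exponentM exponentV ih mulrBr mulr1.
Qed.

Lemma to_heis_exponent v w x : ~~ e v w ->
  (to_heis v w x).1 = (exponent v x, exponent w x).
Proof.
move=> vw; have M := to_heisM vw.
elim/raag_ind: x => [|u x ih|u x ih].
- by rewrite (morph1 M) !exponent1.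
- by rewrite M heis_mulE ih to_heis_gen //= !exponentM !exponent_gen.
- rewrite M (morphV M) heis_mulE heis_invE ih to_heis_gen //=.
  by rewrite !exponentM !exponentV !exponent_gen.
Qed.

Variable V0 : {set V}.

Definition V0_subgroup : set (raag e) :=
  generated [set x | exists2 v, v \in V0 & x = gen v]%classic.

Lemma V0_subgroupP : is_subgroup V0_subgroup.
Proof. exact: generated_subgroup. Qed.

Lemma V0_exponent v x : v \notin V0 -> V0_subgroup x -> exponent v x = 0%R.
Proof.
move=> vV0; apply: (generated_min (H := [set x | exponent v x = 0%R]%classic)).
  split=> [|x' y /= ex ey|x' /= ex]; rewrite /= ?exponent1 //.
    by rewrite exponentM ex ey.
  by rewrite exponentV ex.
move=> _ [u uV0 ->] /=; rewrite exponent_gen; case: eqVneq => // uv.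
by rewrite uv (negPf vV0) in uV0.
Qed.

(** With no letter [w] available the second coordinate stays 0, so the product formula never
    contributes to the central one. *)
Lemma V0_to_heis v w x : ~~ e v w -> w \notin V0 -> V0_subgroup x ->
  (to_heis v w x).2 = 0%R.
Proof.
move=> vw wV0.
have M := to_heisM vw.
suff E : V0_subgroup x -> [/\ exponent w x = 0 & (to_heis v w x).2 = 0]%R.
  by move/E => [].
apply: (generated_min (H := [set x | [/\ exponent w x = 0
          & (to_heis v w x).2 = 0]%R]%classic)).
  split=> [|x' y /= [wx ex] [wy ey]|x' /= [wx ex]]; rewrite /= ?exponent1 //.
  - by rewrite (morph1 M).
  - rewrite exponentM wx wy M heis_mulE /= ex ey to_heis_exponent //=.
    by rewrite to_heis_exponent //= wy mulr0.
  - rewrite exponentV wx (morphV M) heis_invE /= ex.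
    by rewrite to_heis_exponent //= wx mulr0.
move=> _ [u uV0 ->] /=; rewrite exponent_gen to_heis_gen //=.
by case: eqVneq => // uw; rewrite uw (negPf wV0) in uV0.
Qed.

(* [ml v u] and [mr v u] count the letters [v] that [f] puts on the left and on
   the right of the generator [u]. *)
Definition multiplier (ml mr : V -> V -> int) f :=
  exists l r : V -> raag e, forall u,
  [/\ f (gen u) = l u * gen u * r u, V0_subgroup (l u), V0_subgroup (r u),
      u \in V0 -> r u = (l u)^-1 &
      forall v, ml v u = exponent v (l u) /\ mr v u = exponent v (r u)].

(** On the generators in [V0] such an [f] conjugates by elements of [V0_subgroup]. *)
Lemma multiplier_V0 ml mr f x : multiplier ml mr f -> V0_subgroup x ->
  V0_subgroup (f x) /\ forall v, exponent v (f x) = exponent v x.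
Proof.
move=> [l [r fP]]; have [S1 SM SV] := V0_subgroupP.
apply: (generated_min (H := [set x | V0_subgroup (f x) /\
  forall v, exponent v (f x) = exponent v x]%classic)).
  split=> [|y z /= [Sy Ey] [Sz Ez]|y /= [Sy Ey]] /=.
  - by rewrite (morph1 (aut_funM f)).
  - rewrite aut_funM; split=> [|v]; first exact: SM.
    by rewrite !exponentM Ey Ez.
  - rewrite (morphV (aut_funM f)); split=> [|v]; first exact: SV.
    by rewrite !exponentV Ey.
move=> _ [u uV0 ->] /=; have [-> Sl Sr rE _] := fP u; split=> [|v].
  by apply: (SM) => //; apply: SM => //; apply: sub_generated; exists u.
by rewrite rE // !exponentM exponentV addrAC subrr add0r.
Qed.

Lemma multiplier1 : multiplier (fun _ _ => 0%R) (fun _ _ => 0%R) 1.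
Proof.
exists (fun=> 1), (fun=> 1) => u; have [S1 _ _] := V0_subgroupP.
by split=> //; rewrite ?mul1g ?mulg1 ?invg1 // => v; rewrite exponent1.
Qed.

(** The factors that [g] puts around a generator lie in [V0_subgroup], where [f] preserves
    exponents; hence the counts add. *)
Lemma multiplierM ml mr pl pr f g : multiplier ml mr f -> multiplier pl pr g ->
  multiplier (fun v u => ml v u + pl v u)%R (fun v u => mr v u + pr v u)%R (f * g).
Proof.
move=> fK gK; have [l [r fP]] := fK; have [l' [r' gP]] := gK.
have [S1 SM SV] := V0_subgroupP.
exists (fun u => f (l' u) * l u), (fun u => r u * f (r' u)) => u.
have [fE Sl Sr rE fn] := fP u; have [gE Sl' Sr' r'E gn] := gP u.
have [Sfl Efl] := multiplier_V0 fK Sl'; have [Sfr Efr] := multiplier_V0 fK Sr'.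
split.
- by rewrite -[LHS]/(f (g (gen u))) gE !aut_funM fE !mulgA.
- exact: SM.
- exact: SM.
- by move=> uV0; rewrite rE // r'E // (morphV (aut_funM f)) invgM.
- move=> v; have [-> ->] := fn v; have [-> ->] := gn v.
  by rewrite !exponentM Efl Efr addrC.
Qed.

Lemma multiplier_prod (I : Type) (s : seq I) (P : pred I)
    (F : I -> aut (raag e)) (ml mr : I -> V -> V -> int) :
  (forall i, P i -> multiplier (ml i) (mr i) (F i)) ->
  multiplier (fun v u => \sum_(i <- s | P i) ml i v u)%R
    (fun v u => \sum_(i <- s | P i) mr i v u)%R (\prod_(i <- s | P i) F i).
Proof.
move=> FP; elim: s => [|i s ih].
  have E (m : I -> V -> V -> int) :
      (fun v u => \sum_(i <- [::] | P i) m i v u)%R = fun _ _ => 0%R.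
    by apply/funext => v; apply/funext => u; rewrite big_nil.
  by rewrite big_nil !E; exact: multiplier1.
have E (m : I -> V -> V -> int) : (fun v u => \sum_(j <- i :: s | P j) m j v u)%R =
    if P i then fun v u => (m i v u + \sum_(j <- s | P j) m j v u)%R
    else fun v u => (\sum_(j <- s | P j) m j v u)%R.
  by apply/funext => v; apply/funext => u; rewrite big_cons; case: ifP.
by rewrite big_cons !E; case: ifP => // Pi; apply: multiplierM => //; exact: FP.
Qed.

Lemma local_multiplier w m m' f : w \in V0 -> is_local w m m' f ->
  (forall u, u \in V0 -> m' u = (- m u)%R) ->
  multiplier (fun v u => (w == v)%:Z * m u)%R (fun v u => (w == v)%:Z * m' u)%R f.
Proof.
move=> wV0 [mw m'w fE] mm'; have [S1 SM SV] := V0_subgroupP.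
have SX a : V0_subgroup (zexp (gen w) a).
  have SX n : V0_subgroup (gen w ^+ n).
    elim: n => [//|n ih]; rewrite expgS; apply: SM => //.
    by apply: sub_generated; exists w.
  by case: a => n; [exact: SX | exact: (SV _ (SX _))].
exists (fun u => zexp (gen w) (m u)), (fun u => zexp (gen w) (m' u)) => u.
split=> // [uV0|v]; first by rewrite mm' // zexpN.
by rewrite !exponent_zexp exponent_gen.
Qed.

Lemma exponent_inner v (a : raag e) x : exponent v (inner a x) = exponent v x.
Proof.
by rewrite /= conjgE !exponentM exponentV addrC -addrA subrr addr0.
Qed.

Lemma multiplier_inner_sum ml mr (a : raag e) v u :
  multiplier ml mr (inner a) -> v != u -> (ml v u + mr v u = 0)%R.
Proof.
move=> [l [r fP]] vu; have [fE _ _ _ n] := fP u; have [-> ->] := n v.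
have := exponent_inner v a (gen u).
by rewrite fE !exponentM exponent_gen eq_sym (negPf vu) addr0.
Qed.

(* In the Heisenberg quotient, conjugation by [a] multiplies [gen u] by a power
   of the central generator, given by the exponent of [v] in [a]. *)
Lemma multiplier_inner ml mr (a : raag e) v u :
  multiplier ml mr (inner a) -> v != u -> ~~ e v u ->
  ml v u = (- exponent v a)%R.
Proof.
move=> [l [r fP]] vu nvu; have [fE Sl Sr rE n] := fP u.
have [-> _] := n v; have M := to_heisM nvu.
have : (to_heis v u (inner a (gen u))).2 = (- exponent v a)%R.
  rewrite /= conjgE !M (morphV M) to_heis_gen //.
  have := to_heis_exponent a nvu; case: (to_heis v u a) => [[p q] c] /= [-> ->].
  rewrite eqxx [u == v]eq_sym (negPf vu).
  by rewrite !intb; ring.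
rewrite fE !M to_heis_gen // => E.
(* For [u] in [V0] the left side is again a conjugate of [gen u]. Otherwise [l u] and [r u] have
   second and central coordinates 0, and the central coordinate of the product comes from [l u]
   against [gen u] alone. *)
have [uV0|uV0] := boolP (u \in V0).
  move: E; rewrite rE // (morphV M); have := to_heis_exponent (l u) nvu.
  case: (to_heis v u (l u)) => [[p q] c] /= [-> ->].
  rewrite eqxx [u == v]eq_sym (negPf vu) => <-.
  by rewrite !intb; ring.
move: E; rewrite !heis_mulE /= eqxx [u == v]eq_sym (negPf vu).
rewrite !(V0_to_heis nvu) // !to_heis_exponent //= (V0_exponent uV0 Sr) => <-.
by ring.
Qed.

End Invariants.

(** * Components, leaves and twigs *)

Section Graph.
Variables (V : finType) (e : rel V).
Hypotheses (e_sym : symmetric e) (e_irr : irreflexive e).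
Implicit Types (u v w x y z : V) (D : {set V}).

Definition component v x : {set V} := [set y in [set~ v] | connect (del e v) x y].

Lemma in_component v x y :
  (y \in component v x) = (y != v) && connect (del e v) x y.
Proof. by rewrite !inE. Qed.

Lemma connect_del_sym v x y : connect (del e v) x y = connect (del e v) y x.
Proof.
by apply: sym_connect_sym => {}x {}y; rewrite /del e_sym andbCA.
Qed.

Lemma component_components v x : x != v -> component v x \in components e v.
Proof. by move=> xv; apply/imsetP; exists x; rewrite ?inE. Qed.

Lemma component_self v x : x != v -> x \in component v x.
Proof. by move=> xv; rewrite in_component xv connect0. Qed.

Lemma component_eqP v x y : y != v ->
  reflect (component v y = component v x) (y \in component v x).
Proof.
move=> yv; apply: (iffP idP) => [|<-]; last by rewrite in_component yv connect0.
rewrite in_component yv /= => xy; apply/setP => z.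
rewrite !in_component; congr (_ && _).
by rewrite (same_connect (connect_del_sym v) xy).
Qed.

Lemma components_eq v D x : D \in components e v -> x \in D ->
  x != v /\ D = component v x.
Proof.
move=> /imsetP[y]; rewrite !inE => yv -> /[dup] + xD.
rewrite in_component => /andP[xv _]; split=> //.
by apply/esym/component_eqP.
Qed.

Lemma components_neq0 v D : D \in components e v -> exists x, x \in D.
Proof.
by move=> /imsetP[y]; rewrite !inE => yv ->; exists y; apply: component_self.
Qed.

Lemma component_edge v x y : x != v -> y != v -> e x y ->
  component v x = component v y.
Proof.
move=> xv yv xy; apply/esym/component_eqP => //.
by rewrite in_component yv connect1 // /del xv yv.
Qed.

Lemma leaf_component_set1 v x : x != v ->
  reflect (component v x = [set x]) (leaf_component (component v x)).
Proof.
move=> xv; apply: (iffP cards1P) => [[y E]|->]; last by exists x.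
by have := component_self xv; rewrite E inE => /eqP ->.
Qed.

Hypothesis e_conn : connected_graph e.

Lemma connected_neighbour x y : x != y -> exists z, e x z.
Proof.
move=> xy; have /connectP[[|z p] /=] := e_conn x y.
  by move=> _ E; rewrite E eqxx in xy.
by case/andP=> xz _ _; exists z.
Qed.

(** A neighbour other than [v] would lie in the component of [x]; connectedness provides some
    neighbour. *)
Lemma leaf_component_lk v x : x != v -> leaf_component (component v x) ->
  lk e x = [set v].
Proof.
move=> xv /(leaf_component_set1 xv) E.
have [z xz] := connected_neighbour xv.
have nbr y : e x y -> y = v.
  move=> xy; apply/eqP/negP => /negP yv.
  have := component_self yv; rewrite -(component_edge xv yv xy) E inE => /eqP yx.
  by rewrite yx e_irr in xy.
apply/setP => y; rewrite !inE; apply/idP/eqP => [/nbr //|->].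
by rewrite -(nbr z xz).
Qed.

Lemma component_leaf v u : lk e u = [set v] -> component v u = [set u].
Proof.
move=> E; have nbr y : e u y = (y == v) by rewrite -(finset.in_set1 y v) -E inE.
have uv : u != v by apply/eqP => uv; have := nbr v; rewrite eqxx -uv e_irr.
apply/setP => y; rewrite in_component inE; apply/andP/eqP => [[yv]|->].
  case/connectP => -[|z p] /=; first by move=> _ ->.
  by case/andP => /and3P[_ /negPf zv]; rewrite nbr zv.
by split=> //; apply: connect0.
Qed.

(** Take a simple path from [x] to [w]. If it misses [v], it connects [x] to [w] in the complement
    of [v]; otherwise its part up to [v] misses [w]. *)
Lemma component_dichotomy v w x : v != w -> x != v -> x != w ->
  component v x = component v w \/ component w x = component w v.
Proof.
move=> vw xv xw.
have avoid z p : path e x p -> x != z -> z \notin p -> last x p != z ->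
    component z x = component z (last x p).
  move=> xp xz zp lz; apply/esym/component_eqP => //; rewrite in_component lz /=.
  apply/connectP; exists p => //.
  elim: p x xz xp zp {lz xv xw} => //= a p ih x xz /andP[xa ap].
  rewrite inE negb_or => /andP[za zp].
  by rewrite /del xz xa eq_sym za ih // eq_sym.
have /connectP[p0 xp0 pw] := e_conn x w.
case/shortenP: xp0 pw => p xp up _ pw.
have [vp|vp] := boolP (v \in p); last first.
  by left; rewrite pw; apply: avoid => //; rewrite -pw eq_sym.
right; move: xp up pw; case/splitPr: vp => p1 p2.
rewrite -cat_rcons cat_path last_cat last_rcons => /andP[xp1 _].
rewrite -cat_cons cat_uniq => /and3P[_ nin _] pw.
have wp1 : w \notin rcons p1 v.
  have wp2 : w \in p2.
    rewrite pw; case: (p2) pw => [/= E|a p' _ /=]; last exact: mem_last.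
    by rewrite E eqxx in vw.
  by apply: contra nin => wp1; apply/hasP; exists w => //; rewrite inE wp1 orbT.
rewrite -[in RHS](last_rcons x p1 v); apply: avoid => //.
by rewrite last_rcons.
Qed.

Hypothesis e_edges : (2 <= #|edges e|)%N.

(** Two vertices span at most one edge. A third vertex ensures that [gdist], which searches walk
    lengths below [#|V|], reaches length 2. *)
Lemma card_gt2 : (2 < #|V|)%N.
Proof.
rewrite ltnNge; apply/negP => V2.
have : edges e \subset [set [set: V]%SET].
  apply/fintype.subsetP => _ /imsetP[[x y] /= xy ->]; rewrite !inE in xy *.
  rewrite eqEcard finset.subsetT cardsT cards2.
  by have -> : x != y by apply/eqP => E; rewrite E e_irr in xy.
by move/subset_leq_card; rewrite cards1 => /(leq_trans e_edges).
Qed.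

Lemma has_neighbour x : exists y, e x y.
Proof.
have [y yx|xT] := pickP (fun y => y != x).
  by apply: (@connected_neighbour x y); rewrite eq_sym.
have := card_gt2; rewrite -cardsT (_ : [set: V]%SET = [set x]) ?cards1 //.
by apply/setP => y; rewrite !inE; have := xT y; case: eqP.
Qed.

Lemma gdist_le n v x p : (n <= 2)%N -> path e v p -> size p = n -> last v p = x ->
  (gdist e v x <= n)%N.
Proof.
move=> n2 vp sp lp; rewrite leqNgt; apply/negP => n_lt.
have := before_find 0 n_lt; rewrite nth_iota ?add0n; last first.
  by have := card_gt2; lia.
move/negbT/negP; apply; apply/existsP; exists (tcast sp (in_tuple p)).
by rewrite val_tcast /= vp lp eqxx.
Qed.

Lemma gdist_neighbour v x : e v x -> (gdist e v x <= 1)%N.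
Proof. by move=> vx; apply: (@gdist_le 1 v x [:: x]) => //=; rewrite vx. Qed.

Lemma gdist_common_neighbour v y x : e v y -> e y x -> (gdist e v x <= 2)%N.
Proof.
by move=> vy yx; apply: (@gdist_le 2 v x [:: y; x]) => //=; rewrite vy yx.
Qed.

Lemma gdist_gt1 v x : x != v -> ~~ e v x -> (1 < gdist e v x)%N.
Proof.
move=> xv vx; rewrite ltnNge; apply/negP => d1.
have := card_gt2 => V2.
(* A failed search returns [#|V|], so a value at most 1 comes from an actual walk. *)
have H : has (fun n => walk e n v x) (iota 0 #|V|).
  by rewrite has_find size_iota; apply: leq_ltn_trans d1 _; lia.
have := nth_find 0 H; rewrite nth_iota ?add0n; last first.
  by apply: leq_ltn_trans d1 _; lia.
move: d1; rewrite /gdist; case: (find _ _) => [|[|//]] _.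
  case/existsP => p; rewrite tuple0 /= => /eqP vx'.
  by rewrite vx' eqxx in xv.
case/existsP => p; case/tupleP: p => y p; rewrite tuple0 /= andbT.
by case/andP => vy /eqP yx; rewrite -yx vy in vx.
Qed.

(** A neighbour of [x] not adjacent to [v] would be a vertex of the twig at distance 2 from [v],
    like [x], and such vertices are not adjacent. *)
Lemma twig_lk_subset v x : twig e v (component v x) -> x != v -> ~~ e v x ->
  lk e x \subset lk e v.
Proof.
case/and3P=> _ /forallP d2 /forallP nadj xv vx.
apply/fintype.subsetP => z; rewrite !inE => xz; apply/negP => /negP vz.
have zv : z != v by apply: contra vx => /eqP <-; rewrite e_sym.
have xC := component_self xv.
have zC : z \in component v x by rewrite (component_edge xv zv xz) component_self.
have d u : u \in component v x -> u != v -> ~~ e v u -> gdist e v u == 2.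
  move=> uC uv vu; have := implyP (d2 u) uC; have := gdist_gt1 uv vu; lia.
have /forallP /(_ z) := implyP (nadj x) xC.
by rewrite zC d // d //= xz.
Qed.

(** If no such [y] exists, every vertex of the component not adjacent to [v] shares a neighbour with
    [v], and no two of these are adjacent: a twig. The witness cannot have [v] as its chosen vertex,
    so it isolates the exponent of conjugation of the component. *)
Lemma not_twig_witness v x : x != v -> ~~ leaf_component (component v x) ->
  ~~ twig e v (component v x) ->
  exists y, [/\ y \in component v x, ~~ e v y & ~~ (lk e y \subset lk e v)].
Proof.
move=> xv nl; apply: contraNP => nex.
have sub y : y \in component v x -> ~~ e v y -> lk e y \subset lk e v.
  by move=> yC vy; apply/negP => /negP ny; apply: nex; exists y.
rewrite /twig nl /=; apply/andP; split.
  apply/forallP => y; apply/implyP => yC.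
  have [vy|vy] := boolP (e v y); first by apply: leq_trans (gdist_neighbour vy) _.
  have [z yz] := has_neighbour y.
  apply: (@gdist_common_neighbour v z); last by rewrite e_sym.
  by have /fintype.subsetP/(_ z) := sub y yC vy; rewrite !inE; apply.
apply/forallP => y; apply/implyP => yC; apply/forallP => z; apply/implyP => zC.
apply/implyP => /andP[/eqP dy /eqP dz]; apply/negP => yz.
have nvy : ~~ e v y by apply/negP => /gdist_neighbour; rewrite dy.
have nvz : ~~ e v z by apply/negP => /gdist_neighbour; rewrite dz.
have /fintype.subsetP/(_ z) := sub y yC nvy; rewrite !inE => /(_ yz).
by rewrite (negPf nvz).
Qed.

Hypotheses (e_tf : triangle_free e) (e_nstar : ~ is_star e).

(** If [v] were adjacent to all other vertices, an edge avoiding [v] would close a triangle, so the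
    graph would be a star. *)
Lemma exists_nonadjacent v : exists x, x != v /\ ~~ e v x.
Proof.
apply: contrapT => nex; apply: e_nstar; exists v.
have adj w : w != v -> e v w.
  by move=> wv; apply/negP => /negP vw; apply: nex; exists w.
split=> // x y xy; have [|xv] := eqVneq x v; first by left.
have [|yv] := eqVneq y v; first by right.
by have := e_tf (adj x xv) xy; rewrite adj.
Qed.

(** * Maximal vertices and the choice of [V0] *)

Variable V0 : {set V}.
Hypothesis V0P : is_V0 e V0.

Lemma V0_maximal v : v \in V0 -> vmaximal e v.
Proof.
by case/and3P: V0P => _ V0s _ /(fintype.subsetP V0s); rewrite inE.
Qed.

Lemma vequiv_equivalence :
  {in maximal_vertices e & &, equivalence_rel (vequiv e)}.
Proof.
move=> x y z _ _ _; rewrite /vequiv; split; first exact: eqxx.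
by move/eqP ->.
Qed.

(** Maximality turns the inclusion into an equality of links, and [V0] meets each class once. *)
Lemma V0_subset v w : v \in V0 -> w \in V0 -> lk e v \subset lk e w -> v = w.
Proof.
move=> vV0 wV0 vw; have trV0 := V0P.
have [mv mw] := (V0_maximal vV0, V0_maximal wV0).
have wv : lk e w \subset lk e v by apply: (implyP (forallP mv w)).
have E : vequiv e v w by rewrite /vequiv finset.eqEsubset vw wv.
have [vM wM] : v \in maximal_vertices e /\ w \in maximal_vertices e by rewrite !inE.
apply: (pblock_inj trV0) => //; apply/eqP.
have pP := equivalence_partitionP vequiv_equivalence.
case/and3P: (pP) => /eqP cov triv _.
rewrite eq_pblock ?cov //.
by rewrite pblock_equivalence_partition //; exact: vequiv_equivalence.
Qed.

Variable c : V -> V.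
Hypothesis cP : forall v, v \notin V0 -> c v \in V0 /\ vle e v (c v).

Lemma lk_le v w x : lk e v \subset lk e w -> e v x -> e w x.
Proof. by move/fintype.subsetP/(_ x); rewrite !inE. Qed.

(** If a leaf [v] at [w] were maximal, every neighbour of [w] would have link [[set w]], and no path
    could lead from [w] to a vertex not adjacent to it. *)
Lemma leaf_notin_V0 v w : lk e v = [set w] -> v \notin V0.
Proof.
move=> E; apply/negP => vV0.
have vw : e v w by have := finset.set11 w; rewrite -E inE.
have [x [xw nwx]] := exists_nonadjacent w.
have nbr z : e w z -> lk e z = [set w].
  move=> wz; have vz : vle e v z by rewrite /vle E finset.sub1set inE e_sym.
  have zv := implyP (forallP (V0_maximal vV0) z) vz.
  by apply/eqP; rewrite -E finset.eqEsubset; apply/andP; split.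
have : connect e w x by apply: e_conn.
case/connectP => p; elim/last_ind: p x xw nwx => [|p y ih] x xw nwx /=.
  by move=> _ xw'; rewrite xw' eqxx in xw.
rewrite rcons_path last_rcons => /andP[wp ly] xy.
have [lw|lw] := eqVneq (last w p) w; first by rewrite xy -{1}lw ly in nwx.
have [wl|wl] := boolP (e w (last w p)); last exact: (ih _ lw wl wp).
have : y \in lk e (last w p) by rewrite inE.
by rewrite (nbr _ wl) inE -xy (negPf xw).
Qed.

(** Otherwise [c v] would be a second neighbour of [u]. *)
Lemma leaf_neighbour_in_V0 u v : lk e u = [set v] -> v \in V0.
Proof.
move=> E; apply/negP => /negP vV0; have [cV0 vc] := cP vV0.
have : c v \in lk e u.
  rewrite inE e_sym; apply: (lk_le vc); rewrite e_sym.
  by have := finset.set11 v; rewrite -E inE.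
by rewrite E inE => /eqP cv; rewrite cv (negPf vV0) in cV0.
Qed.

Lemma chosen_neq u v : u \notin V0 -> c u = v -> [/\ u != v, ~~ e v u & ~~ e u v].
Proof.
move=> uV0 <-; have [cV0 uc] := cP uV0.
have n : ~~ e u (c u) by apply/negP => /(lk_le uc); rewrite e_irr.
by split=> //; [apply: contraNneq uV0 => -> | rewrite e_sym].
Qed.

(** The link of [x] lies in that of [v], so [x] is not in [V0]. If [c x] were not [v], a common
    neighbour would put it in the same twig, not adjacent to [v] for lack of triangles; then its
    link would also lie in that of [v], contradicting [V0_subset]. *)
Lemma twig_chosen v x : v \in V0 -> x != v -> ~~ e v x ->
  twig e v (component v x) ->
  x \notin V0 /\ c x = v.
Proof.
move=> vV0 xv vx tw; have xle := twig_lk_subset tw xv vx.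
have xV0 : x \notin V0.
  by apply/negP => xV0; rewrite (V0_subset xV0 vV0 xle) eqxx in xv.
split=> //; apply/eqP/negP => /negP cxv; have [cV0 xc] := cP xV0.
have [y xy] := has_neighbour x.
have vy : e v y by apply: lk_le xle xy.
have cy : e (c x) y by apply: lk_le xc xy.
have yv : y != v by apply: contraTneq vy => ->; rewrite e_irr.
have nvc : ~~ e v (c x).
  by have := e_tf cy; rewrite e_sym => /(_ v); rewrite e_sym vy; apply.
have E : component v (c x) = component v x.
  by rewrite (component_edge cxv yv cy) (component_edge xv yv xy).
have : lk e (c x) \subset lk e v by apply: twig_lk_subset => //; rewrite E.
by move/(V0_subset cV0 vV0)/eqP; rewrite (negPf cxv).
Qed.

(** Replacing [v] by [c v] sends edges to edges, so it turns paths through [v] into paths avoiding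
    [v]. *)
Lemma component_notin_V0 v x : v \notin V0 -> x != v -> component v x = [set~ v].
Proof.
move=> vV0 xv; have [cV0 vc] := cP vV0; have [vcv ncv nvc] := chosen_neq vV0 erefl.
suff E y : y != v -> component v y = component v (c v).
  apply/setP => y; rewrite [in RHS]inE inE; case: eqVneq => [->|yv].
    by rewrite in_component eqxx.
  by apply/component_eqP => //; rewrite !E.
pose h z := if z == v then c v else z.
have hv z : h z != v by rewrite /h; case: (eqVneq z v) => // _; rewrite eq_sym.
have hE a b : e a b -> e (h a) (h b).
  rewrite /h; case: (eqVneq a v) => [->|av]; case: (eqVneq b v) => [->|bv] //.
  - by rewrite e_irr.
  - exact: lk_le.
  - by rewrite e_sym => /(lk_le vc); rewrite e_sym.
move=> yv; have /connectP[p yp lp] := e_conn y v.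
have -> : y = h y by rewrite /h (negPf yv).
have -> : c v = h (last y p) by rewrite -lp /h eqxx.
elim: p y {yv lp} yp => //= z p ih y /andP[yz zp].
by rewrite -ih //; apply: component_edge => //; apply: hE.
Qed.

(** A neighbour of [u] is also one of [v], and it is not [w]. *)
Lemma component_chosen u v w : u \notin V0 -> c u = v -> w != v -> w != u ->
  ~~ e v w -> component w u = component w v.
Proof.
move=> uV0 cu wv wu vw; have [y uy] := has_neighbour u.
have [_ uc] := cP uV0; rewrite cu in uc; have vy := lk_le uc uy.
have yw : y != w by apply: contraNneq vw => <-.
rewrite eq_sym in wu; rewrite eq_sym in wv.
by rewrite (component_edge wu yw uy) -(component_edge wv yw vy).
Qed.

(** * The homomorphism Phi *)

Local Notation gen := (gen e).

(* [inl (u, true)] and [inl (u, false)] index the left and right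
   transvections of [u] by [c u]; [inr (v, D)] indexes the partial conjugation of [D] by [v],
   or the leaf transvection by [v] if [D] is a leaf component at [v]. *)
Definition gen_index := ((V * bool) + (V * {set V}))%type.
Implicit Types (n : gen_index -> int) (t : gen_index) (f : aut (raag e)).

Definition valid t :=
  match t with
  | inl (u, _) => u \notin V0
  | inr (v, D) => [&& v \in V0, D \in components e v & ~~ twig e v D]
  end.

Definition owner t := match t with inl (u, _) => c u | inr (v, _) => v end.

(* The coefficients of the relation expressing that conjugation by a vertex of
   [V0] is inner. *)
Definition rel_coef t : int :=
  match t with
  | inl (u, b) =>
    if twig e (c u) (component (c u) u) then (if b then 1 else -1)%R else 0%R
  | inr (_, D) => if leaf_component D then 0%R else 1%R
  end.

Definition chosen v x := (x \notin V0) && (c x == v).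

(** Twigs give no valid index, and the index of a leaf component stands for a transvection, which
    enters [right_exp] separately. *)
Definition conj_exp n v D : int :=
  if leaf_component D || twig e v D then 0%R else n (inr (v, D)).

Definition left_exp n v x : int :=
  if x == v then 0%R
  else ((if chosen v x then n (inl (x, true)) else 0)
        + conj_exp n v (component v x))%R.

Definition right_exp n v x : int :=
  if x == v then 0%R
  else ((if chosen v x then n (inl (x, false)) else 0)
        + (if leaf_component (component v x) then n (inr (v, component v x)) else 0)
        - conj_exp n v (component v x))%R.

Lemma left_expD n n' v x :
  left_exp (fun t => n t + n' t)%R v x = (left_exp n v x + left_exp n' v x)%R.
Proof. by rewrite /left_exp /conj_exp; do !case: ifP => _ //; ring. Qed.

Lemma right_expD n n' v x :
  right_exp (fun t => n t + n' t)%R v x = (right_exp n v x + right_exp n' v x)%R.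
Proof. by rewrite /right_exp /conj_exp; do !case: ifP => _ //; ring. Qed.

Lemma chosenP v x : chosen v x -> [/\ x != v, ~~ e v x & lk e x \subset lk e v].
Proof.
case/andP => xV0 /eqP cx; have [xv vx _] := chosen_neq xV0 cx.
by split=> //; have [_] := cP xV0; rewrite cx.
Qed.

Lemma chosen_V0 v x : x \in V0 -> chosen v x = false.
Proof. by rewrite /chosen => ->. Qed.

Lemma chosen_nbr v x : e v x -> chosen v x = false.
Proof. by move=> vx; apply/negP => /chosenP[_]; rewrite vx. Qed.

Lemma leaf_component_V0 v x : x != v -> x \in V0 ->
  leaf_component (component v x) = false.
Proof.
move=> xv xV0; apply/negP => /(leaf_component_lk xv)/leaf_notin_V0.
by rewrite xV0.
Qed.

Lemma leaf_component_nbr v x : x != v -> leaf_component (component v x) -> e v x.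
Proof.
by move=> xv /(leaf_component_lk xv) E; rewrite e_sym -[e x v]inE -/(lk e x) E inE.
Qed.

Lemma edge_not_leaf v x y : x != v -> y != v -> e x y ->
  leaf_component (component v x) = false.
Proof.
move=> xv yv xy; apply/negP => /(leaf_component_lk xv) E.
have : y \in lk e x by rewrite inE.
by rewrite E inE (negPf yv).
Qed.

(** Adjacent [x] and [y] lie in the same component, which is not a leaf. If one of them has a
    transvection by [v], its link lies in that of [v], so the other is adjacent to [v] and merely
    conjugated; if neither has, both are conjugated alike. *)
Lemma exp_admissible n v : local_admissible e v (left_exp n v) (right_exp n v).
Proof.
split=> [||x y xv yv xy]; rewrite /left_exp /right_exp ?eqxx //.
have yx : e y x by rewrite e_sym.
rewrite (negPf xv) (negPf yv) (component_edge xv yv xy) (edge_not_leaf yv xv yx).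
have [xc|xc] := boolP (chosen v x).
  have [_ _ xle] := chosenP xc; have vy := lk_le xle xy.
  by rewrite (chosen_nbr vy); constructor 3; split=> //; ring.
have [yc|yc] := boolP (chosen v y).
  have [_ _ yle] := chosenP yc; have vx := lk_le yle yx.
  by constructor 2; split=> //; ring.
by constructor 1; split; ring.
Qed.

Definition vertex_aut n v : aut (raag e) :=
  sval (cid (local_exists e_sym (exp_admissible n v))).

Lemma vertex_aut_local n v :
  is_local v (left_exp n v) (right_exp n v) (vertex_aut n v).
Proof. by rewrite /vertex_aut; case: cid => f fL /=. Qed.

Lemma vertex_autE n v m m' f : is_local v m m' f ->
  (forall x, x != v -> left_exp n v x = m x /\ right_exp n v x = m' x \/
     [/\ e v x & (left_exp n v x + right_exp n v x = m x + m' x)%R]) ->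
  vertex_aut n v = f.
Proof. exact: local_uniq (vertex_aut_local n v). Qed.

Lemma vertex_autD n n' v :
  vertex_aut (fun t => n t + n' t)%R v = vertex_aut n v * vertex_aut n' v.
Proof.
apply: vertex_autE (local_mul (vertex_aut_local n v) (vertex_aut_local n' v)) _.
by move=> x _; left; rewrite left_expD right_expD.
Qed.

Lemma is_local1 v : is_local v (fun=> 0%R) (fun=> 0%R) (1 : aut (raag e)).
Proof. by split=> // x; rewrite mul1g mulg1. Qed.

(** With [vertex_autD], this shows that only the values at valid indices owned by [v] matter. *)
Lemma vertex_aut1 n v : (forall t, valid t -> owner t = v -> n t = 0%R) ->
  v \in V0 -> vertex_aut n v = 1.
Proof.
move=> n0 vV0; apply: vertex_autE (is_local1 v) _ => x xv; left.
rewrite /left_exp /right_exp /conj_exp (negPf xv).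
have E b : (if chosen v x then n (inl (x, b)) else 0%R) = 0%R.
  by case: ifP => // /andP[xV0 /eqP cx]; apply: n0.
have ED : ~~ twig e v (component v x) -> n (inr (v, component v x)) = 0%R.
  by move=> tw; apply: n0 => //=; rewrite vV0 component_components.
rewrite !E; have [lf|_] /= := boolP (leaf_component (component v x)).
  by rewrite ED // /twig lf.
by have [//|tw] := boolP (twig e v (component v x)); rewrite ED.
Qed.

Lemma right_exp_V0 n v w : w \in V0 -> right_exp n v w = (- left_exp n v w)%R.
Proof.
move=> wV0; rewrite /right_exp /left_exp; case: eqVneq => [_|wv].
  by rewrite oppr0.
by rewrite chosen_V0 // leaf_component_V0 //; ring.
Qed.

Lemma exp_same_component n v w x : w \in V0 -> w != v -> x != v -> w != x ->
  component v x = component v w -> ~~ chosen v x ->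
  left_exp n v x = left_exp n v w /\ right_exp n v x = (- left_exp n v w)%R.
Proof.
move=> wV0 wv xv wx E xc.
rewrite /left_exp /right_exp (negPf xv) (negPf wv) (negPf xc) chosen_V0 // E.
by rewrite leaf_component_V0 //; split; ring.
Qed.

(** For nonadjacent [v] and [w], a vertex with a transvection by [v] lies with [v] in the complement
    of [w] and has none by [w], and symmetrically. For the other vertices [component_dichotomy]
    decides which of the two automorphisms acts by the common conjugation. *)
Lemma vertex_aut_commute n n' v w : v \in V0 -> w \in V0 ->
  commute (to_out (vertex_aut n v)) (to_out (vertex_aut n' w)).
Proof.
move=> vV0 wV0; have fL := vertex_aut_local n v; have gL := vertex_aut_local n' w.
have [<-|vw] := eqVneq v w.
  rewrite /commute -!to_outM -!vertex_autD; congr (to_out (vertex_aut _ v)).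
  by apply/funext => t; rewrite addrC.
have [vAw|nvw] := boolP (e v w).
  rewrite /commute -!to_outM; congr to_out.
  by apply: (local_commute_nbr e_sym vAw fL gL); apply: right_exp_V0.
have nwv : ~~ e w v by rewrite e_sym.
apply: (local_commute_out vw fL gL); try exact: right_exp_V0.
have wv : w != v by rewrite eq_sym.
move=> x xv xw; have vx : v != x by rewrite eq_sym.
have wx : w != x by rewrite eq_sym.
have cR : chosen v x ->
    component w x = component w v /\ ~~ chosen w x.
  case/andP => xV0 /eqP cx; split; first exact: (component_chosen xV0 cx).
  by rewrite /chosen cx (negPf vw) andbF.
have cL : chosen w x -> component v x = component v w /\ ~~ chosen v x.
  case/andP => xV0 /eqP cx; split; first exact: (component_chosen xV0 cx).
  by rewrite /chosen cx (negPf wv) andbF.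
have [xcv|xcv] := boolP (chosen v x).
  by right; have [? ?] := cR xcv; apply: exp_same_component.
have [xcw|xcw] := boolP (chosen w x).
  by left; have [? ?] := cL xcw; apply: exp_same_component.
by case: (component_dichotomy vw xv xw) => E;
  [left | right]; apply: exp_same_component.
Qed.

Definition Phi n : out (raag e) := \prod_(v in V0) to_out (vertex_aut n v).

Lemma PhiD n n' : Phi (fun t => n t + n' t)%R = Phi n * Phi n'.
Proof.
rewrite /Phi -prodgM_commute => [|v w vV0 wV0]; last exact: vertex_aut_commute.
by apply: eq_bigr => v _; rewrite vertex_autD to_outM.
Qed.

(** The factor at [v] conjugates everything by the [k v]-th power of [v]. In a twig the vertices not
    adjacent to [v] are handled by their two transvections, with coefficients 1 and -1; at
    neighbours of [v] only the zero total exponent counts. *)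
Lemma Phi_rel (k : V -> int) : Phi (fun t => k (owner t) * rel_coef t)%R = 1.
Proof.
apply: big1 => v vV0; rewrite (vertex_autE (inner_local e v (k v))).
  exact: to_out_inner.
move=> x xv; rewrite /constant_off (negPf xv) /left_exp /right_exp (negPf xv).
have [vx|nvx] := boolP (e v x).
  right; split=> //; rewrite chosen_nbr //= /conj_exp /=.
  by case: (leaf_component _) => /=; [|case: (twig _ _ _)]; ring.
left; have lf : leaf_component (component v x) = false.
  by apply/negP => /(leaf_component_nbr xv); rewrite (negPf nvx).
rewrite /conj_exp /= lf /=; have [tw|tw] := boolP (twig e v (component v x)).
  have [xV0 cx] := twig_chosen vV0 xv nvx tw.
  by rewrite /chosen xV0 cx eqxx tw /=; split; ring.
rewrite /chosen; have [xc|_] := boolP (_ && _); last by split; ring.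
by case/andP: xc => _ /eqP ->; rewrite (negPf tw); split; ring.
Qed.

(** If the product is [inner a], then [k v] is minus the exponent of [v] in [a]. It equals the left
    exponent at each vertex not adjacent to [v], and all total exponents vanish; each coefficient is
    read off at a suitable vertex. *)
Lemma Phi_inj n : Phi n = 1 ->
  exists k : V -> int, forall t, valid t -> n t = (k (owner t) * rel_coef t)%R.
Proof.
have toM : {morph @to_out (raag e) : f g / f * g >-> f * g} := @to_outM _ e.
rewrite /Phi -(morph_prod toM) => Phi1.
have [a Fa] : exists a : raag e, \prod_(v in V0) vertex_aut n v = inner a.
  have /to_outP[a] : to_out (\prod_(v in V0) vertex_aut n v) = to_out 1.
    by rewrite Phi1.
  by rewrite mulg1; exists a.
have : multiplier V0
    (fun v u => \sum_(w in V0) (w == v)%:Z * left_exp n w u)%R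
    (fun v u => \sum_(w in V0) (w == v)%:Z * right_exp n w u)%R
    (\prod_(v in V0) vertex_aut n v).
  apply: multiplier_prod => // v vV0.
  apply: (local_multiplier e_sym e_irr vV0 (vertex_aut_local n v)) => u uV0.
  exact: right_exp_V0.
rewrite Fa => M.
have sumE (m : V -> V -> int) v u : v \in V0 ->
    (\sum_(w in V0) (w == v)%:Z * m w u)%R = m v u.
  move=> vV0; rewrite (bigD1 v) //= eqxx mul1r big1 ?addr0 // => w.
  by case/andP=> _ /negPf ->; rewrite mul0r.
pose k v := (- exponent v a)%R.
have Msum v u : v \in V0 -> u != v -> (right_exp n v u = - left_exp n v u)%R.
  move=> vV0; rewrite eq_sym => /(multiplier_inner_sum e_sym e_irr M).
  by rewrite !sumE // addrC => /eqP; rewrite addr_eq0 => /eqP.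
have Minn v u : v \in V0 -> u != v -> ~~ e v u -> left_exp n v u = k v.
  move=> vV0; rewrite eq_sym => vu /(multiplier_inner e_sym e_irr M vu).
  by rewrite sumE.
have noleaf v u : u != v -> ~~ e v u -> leaf_component (component v u) = false.
  by move=> uv nvu; apply/negP => /(leaf_component_nbr uv); rewrite (negPf nvu).
have left_comp v D : v \in V0 -> D \in components e v -> ~~ leaf_component D ->
    ~~ twig e v D -> n (inr (v, D)) = k v.
  move=> vV0 DC; have [x xD] := components_neq0 DC.
  have [xv DE] := components_eq DC xD; rewrite DE => nlf ntw.
  have [y [yC nvy nle]] := not_twig_witness xv nlf ntw.
  rewrite -DE in yC; have [yv DE'] := components_eq DC yC.
  have := Minn v y vV0 yv nvy; rewrite /left_exp (negPf yv).
  have -> : chosen v y = false by apply/negP => /chosenP[_ _]; rewrite (negPf nle).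
  by rewrite -DE' DE /conj_exp (negPf nlf) (negPf ntw) add0r.
exists k => -[[u b]|[v D]] /=.
  move=> uV0; have [vV0 _] := cP uV0.
  have ch : chosen (c u) u by rewrite /chosen uV0 /=.
  have [uv nvu _] := chosenP ch; have lf := noleaf _ _ uv nvu.
  have nl : n (inl (u, true)) = (k (c u) * rel_coef (inl (u, true)))%R.
    have := Minn _ _ vV0 uv nvu; rewrite /left_exp (negPf uv) ch /conj_exp lf /=.
    case: ifP => [_ <-|/negbT tw]; first by ring.
    rewrite left_comp ?component_components ?lf // => E.
    by apply: (addIr (k (c u))); rewrite E; ring.
  (* The right coefficient follows from the left one, because the exponents at [u] sum to 0. *)
  case: b => //; have := Msum _ _ vV0 uv.
  rewrite /left_exp /right_exp (negPf uv) ch lf nl /= => E.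
  transitivity (- (k (c u) *
      (if twig e (c u) (component (c u) u) then 1 else 0)))%R;
    last by case: ifP => _; ring.
  by apply: (addIr (- conj_exp n (c u) (component (c u) u))%R);
    rewrite -opprD -E addr0.
case/and3P => vV0 DC tw; case: ifP => [lf|/negbT lf];
  last by rewrite left_comp // mulr1.
have [x xD] := components_neq0 DC; have [xv DE] := components_eq DC xD.
move: lf; rewrite DE => lf; have vx := leaf_component_nbr xv lf.
(* A leaf transvection is seen in the total exponent at the leaf. *)
have := Msum v x vV0 xv; rewrite /left_exp /right_exp (negPf xv) lf.
by rewrite (chosen_nbr vx) /conj_exp lf /= mulr0 addr0 add0r oppr0.
Qed.

Lemma Phi0 : Phi (fun=> 0%R) = 1.
Proof.
by apply: (mulgI (Phi (fun=> 0%R))); rewrite -PhiD mulg1.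
Qed.

Lemma PhiN n : Phi (fun t => - n t)%R = (Phi n)^-1.
Proof.
apply: (mulgI (Phi n)); rewrite -PhiD mulgV -Phi0; congr Phi.
by apply/funext => t; rewrite subrr.
Qed.

Lemma Phi_single n v : v \in V0 ->
  (forall t, valid t -> owner t != v -> n t = 0%R) ->
  Phi n = to_out (vertex_aut n v).
Proof.
move=> vV0 n0; apply: big_only1 => // w wv wV0; rewrite vertex_aut1 //.
by move=> t tV ow; apply: n0 => //; rewrite ow.
Qed.

(** * The generators of A, L and C as values of [Phi] *)

Definition gen_delta t : gen_index -> int := fun s => (s == t)%:Z%R.

Lemma components_mem v D x : D \in components e v ->
  (x \in D) = (x != v) && (component v x == D).
Proof.
move=> DC; apply/idP/andP => [/(components_eq DC)[-> ->]//|[xv /eqP <-]].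
exact: component_self.
Qed.

Lemma vertex_aut_delta_inl u b : u \notin V0 ->
  is_local (c u) (fun x => (b && (x == u))%:Z)%R (fun x => (~~ b && (x == u))%:Z)%R
    (vertex_aut (gen_delta (inl (u, b))) (c u)).
Proof.
move=> uV0; have ch : chosen (c u) u by rewrite /chosen uV0 /=.
have [uv _ _] := chosenP ch.
have E b' x :
    (if chosen (c u) x then gen_delta (inl (u, b)) (inl (x, b')) else 0%R) =
    ((b == b') && (x == u))%:Z%R.
  rewrite /gen_delta (inj_eq (@inl_inj _ _)) xpair_eqE andbC [b' == b]eq_sym.
  by case: (eqVneq x u) => [->|_]; rewrite ?ch ?andbF //; case: ifP.
suff H : is_local (c u) (left_exp (gen_delta (inl (u, b))) (c u))
                  (right_exp (gen_delta (inl (u, b))) (c u))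
                  (vertex_aut (gen_delta (inl (u, b))) (c u)).
  congr is_local: H; apply/funext => x; rewrite /left_exp /right_exp.
  - case: eqVneq => [->|_]; first by rewrite eq_sym (negPf uv) andbF.
    by rewrite E /conj_exp /= if_same addr0; case: (b).
  - case: eqVneq => [->|_]; first by rewrite eq_sym (negPf uv) andbF.
    by rewrite E /conj_exp /= !if_same subr0 addr0; case: (b).
exact: vertex_aut_local.
Qed.

Lemma vertex_aut_delta_inr v D : D \in components e v -> ~~ twig e v D ->
  is_local v (fun x => (~~ leaf_component D && (x \in D))%:Z)%R
    (fun x => if leaf_component D then (x \in D)%:Z else - (x \in D)%:Z)%R
    (vertex_aut (gen_delta (inr (v, D))) v).
Proof.
move=> DC ntw.
have E x : x != v ->
    gen_delta (inr (v, D)) (inr (v, component v x)) = (x \in D)%:Z%R.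
  move=> xv; rewrite /gen_delta (inj_eq (@inr_inj _ _)) xpair_eqE eqxx.
  by rewrite (components_mem _ DC) xv.
have EC x : x != v -> conj_exp (gen_delta (inr (v, D))) v (component v x) =
    (~~ leaf_component D && (x \in D))%:Z%R.
  move=> xv; rewrite /conj_exp E // (components_mem _ DC) xv /=.
  by case: eqVneq => [->|_]; rewrite ?(negPf ntw) ?orbF ?andbT ?andbF; case: ifP.
have vD : v \notin D by rewrite (components_mem _ DC) eqxx.
suff H : is_local v (left_exp (gen_delta (inr (v, D))) v)
                  (right_exp (gen_delta (inr (v, D))) v)
                  (vertex_aut (gen_delta (inr (v, D))) v).
  congr is_local: H; apply/funext => x; rewrite /left_exp /right_exp.
  - case: eqVneq => [->|xv]; first by rewrite (negPf vD) andbF.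
    by rewrite EC // if_same add0r.
  - case: eqVneq => [->|xv]; first by rewrite (negPf vD) oppr0 if_same.
    rewrite EC // if_same add0r E // (components_mem _ DC) xv /=.
    case: (eqVneq (component v x) D) => [->|_]; first by case: (leaf_component D).
    by rewrite andbF if_same oppr0 if_same subr0.
exact: vertex_aut_local.
Qed.

Lemma left_transvection_vertex_aut u f : u \notin V0 ->
  left_transvection u (c u) f <->
  f = vertex_aut (gen_delta (inl (u, true))) (c u).
Proof.
move=> uV0; have [_ _ E] := vertex_aut_delta_inl true uV0.
have Eu := E u; have Ex x (xu : x != u) := E x; rewrite /= eqxx mulg1 in Eu.
split=> [[fu fx]|->]; last first.
  by split=> // x xu; rewrite Ex //= (negPf xu) mul1g mulg1.
apply: raag_aut_eq => x; have [->|xu] := eqVneq x u; first by rewrite fu Eu.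
by rewrite fx // Ex //= (negPf xu) mul1g mulg1.
Qed.

Lemma right_transvection_vertex_aut u f : u \notin V0 ->
  right_transvection u (c u) f <->
  f = vertex_aut (gen_delta (inl (u, false))) (c u).
Proof.
move=> uV0; have [_ _ E] := vertex_aut_delta_inl false uV0.
have Eu := E u; have Ex x (xu : x != u) := E x; rewrite /= eqxx mul1g in Eu.
split=> [[fu fx]|->]; last first.
  by split=> // x xu; rewrite Ex //= (negPf xu) mul1g mulg1.
apply: raag_aut_eq => x; have [->|xu] := eqVneq x u; first by rewrite fu Eu.
by rewrite fx // Ex //= (negPf xu) mul1g mulg1.
Qed.

Lemma leaf_not_twig v D : leaf_component D -> ~~ twig e v D.
Proof. by move=> lf; rewrite /twig lf. Qed.

Lemma leaf_transvection_vertex_aut u v f : lk e u = [set v] ->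
  right_transvection u v f <-> f = vertex_aut (gen_delta (inr (v, [set u]))) v.
Proof.
move=> uv; have uneq : u != v.
  apply/eqP => E; have := finset.set11 v.
  by rewrite -uv inE E e_irr.
have lf : leaf_component [set u] by rewrite /leaf_component cards1.
have DC : [set u] \in components e v.
  by rewrite -(component_leaf uv) component_components.
have [_ _ E] := vertex_aut_delta_inr DC (leaf_not_twig v lf).
rewrite lf /= in E.
have Eu := E u; have Ex x (xu : x != u) := E x.
rewrite finset.in_set1 eqxx mul1g in Eu.
split=> [[fu fx]|->]; last first.
  by split=> // x xu; rewrite Ex // finset.in_set1 (negPf xu) mul1g mulg1.
apply: raag_aut_eq => x; have [->|xu] := eqVneq x u; first by rewrite fu Eu.
by rewrite fx // Ex // finset.in_set1 (negPf xu) mul1g mulg1.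
Qed.

Lemma partial_conjugation_local v D f : D \in components e v ->
  partial_conjugation v D f ->
  is_local v (fun x => (x \in D)%:Z)%R (fun x => - (x \in D)%:Z)%R f.
Proof.
move=> DC fD; have vD : v \notin D by rewrite (components_mem _ DC) eqxx.
split=> [||x]; rewrite ?(negPf vD) ?oppr0 // fD.
by case: ifP => _; rewrite ?mul1g ?mulg1.
Qed.

Lemma partial_conjugation_vertex_aut v D f : D \in components e v ->
  ~~ leaf_component D -> ~~ twig e v D ->
  partial_conjugation v D f <-> f = vertex_aut (gen_delta (inr (v, D))) v.
Proof.
move=> DC lf tw; have fL := vertex_aut_delta_inr DC tw; rewrite (negPf lf) in fL.
split=> [/(partial_conjugation_local DC) fD|->].
  by apply: (local_uniq fD fL) => x _; left.
move=> x; have [_ _ ->] := fL; case: (x \in D) => //=.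
by rewrite mul1g mulg1.
Qed.

Lemma Phi_delta t : valid t ->
  Phi (gen_delta t) = to_out (vertex_aut (gen_delta t) (owner t)).
Proof.
move=> tV; apply: Phi_single => [|s sV st].
  by case: t tV => [[u b] uV0|[v D] /and3P[]//]; have [] := cP uV0.
by rewrite /gen_delta; case: eqVneq => // E; rewrite E eqxx in st.
Qed.

Lemma partial_conjugation_in_range v D f : D \in components e v ->
  partial_conjugation v D f -> exists n, Phi n = to_out f.
Proof.
move=> DC fD; have fL := partial_conjugation_local DC fD.
have [x xD] := components_neq0 DC; have [xv DE] := components_eq DC xD.
have [vV0|vV0] := boolP (v \in V0); last first.
  (* The complement of [v] is connected, so [f] is conjugation by [v]. *)
  exists (fun=> 0%R); rewrite Phi0 -(to_out_inner (zexp (gen v) (- 1)%R)).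
  congr to_out; apply: local_uniq (inner_local e v 1%R) fL _ => y yv; left.
  rewrite /constant_off (negPf yv) DE component_notin_V0 //.
  by rewrite inE finset.in_set1 yv.
have [lf|lf] := boolP (leaf_component D).
  (* A leaf component is a neighbour of [v], so [f] is the identity. *)
  exists (fun=> 0%R); rewrite Phi0; have toM : to_out (1 : aut (raag e)) = 1.
    by rewrite -(to_out_inner 1) inner1.
  rewrite -toM; congr to_out; apply: local_uniq (is_local1 v) fL _ => y yv.
  have [yD|yD] := boolP (y \in D); last by left; rewrite oppr0.
  right; split; last by rewrite subrr.
  have [_ DE'] := components_eq DC yD; apply: leaf_component_nbr => //.
  by rewrite -DE'.
have [tw|tw] := boolP (twig e v D); last first.
  exists (gen_delta (inr (v, D))); rewrite Phi_delta; last by rewrite /= vV0 DC.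
  by congr to_out; apply/esym/partial_conjugation_vertex_aut.
(* In a twig, left transvections and inverse right ones conjugate the vertices not adjacent to [v];
   its other vertices commute with [v]. *)
pose n t : int := match t with
  | inl (u, b) => if (c u == v) && (u \in D) then (if b then 1 else -1)%R else 0%R
  | inr _ => 0%R end.
exists n; rewrite (@Phi_single _ v) //; last first.
  by move=> [[u b]|//] /= _ /negPf ->.
congr to_out; apply: vertex_autE fL _ => y yv.
rewrite /left_exp /right_exp (negPf yv) /conj_exp /= !if_same subr0 !addr0.
have [vy|nvy] := boolP (e v y).
  right; split=> //; by rewrite chosen_nbr // [RHS]subrr addr0.
left; have [yD|yD] := boolP (y \in D); last by rewrite andbF if_same.
have [_ DE'] := components_eq DC yD; rewrite DE' in tw.
have [yV0 cy] := twig_chosen vV0 yv nvy tw.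
by rewrite /chosen yV0 cy eqxx.
Qed.

Lemma range_Phi_subgroup : is_subgroup [set g | exists n, Phi n = g]%classic.
Proof.
split=> [|_ _ [n <-] [n' <-]|_ [n <-]].
- by exists (fun=> 0%R); rewrite Phi0.
- by exists (fun t => n t + n' t)%R; rewrite PhiD.
- by exists (fun t => - n t)%R; rewrite PhiN.
Qed.

Lemma G_in_range g : G_subgroup e V0 c g -> exists n, Phi n = g.
Proof.
apply: (generated_min range_Phi_subgroup) => _ [f fG <-] /=.
have preim : is_subgroup [set f | exists n, Phi n = to_out f]%classic.
  have [R1 RM RV] := range_Phi_subgroup.
  have toM : {morph @to_out (raag e) : f g / f * g >-> f * g} := @to_outM _ e.
  split=> [|f1 f2 E1 E2|f1 E1] /=; first by rewrite (morph1 toM).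
    by rewrite to_outM; apply: (RM _ _ E1 E2).
  by rewrite (morphV toM); apply: (RV _ E1).
case: fG => [[fA|fL]|fC].
- apply: (generated_min preim _ fA) => f' [v [vV0 []]] /=.
    move/left_transvection_vertex_aut => /(_ vV0) ->.
    by exists (gen_delta (inl (v, true))); rewrite Phi_delta.
  move/right_transvection_vertex_aut => /(_ vV0) ->.
  by exists (gen_delta (inl (v, false))); rewrite Phi_delta.
- apply: (generated_min preim _ fL) => f' [u [v [/cards1P[w uw]]]] /=.
  rewrite uw inE => /eqP -> /(leaf_transvection_vertex_aut _ uw) ->.
  exists (gen_delta (inr (w, [set u]))); rewrite Phi_delta //=.
  rewrite (leaf_neighbour_in_V0 uw) leaf_not_twig /leaf_component ?cards1 // andbT.
  rewrite -(component_leaf uw) component_components //.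
  apply/eqP => E; have := finset.set11 w.
  by rewrite -uw inE E e_irr.
- apply: (generated_min preim _ fC) => f' [v [D [DC]]].
  exact: partial_conjugation_in_range.
Qed.

(** Arbitrary indices are allowed because [int_fun_ind] ranges over all delta functions; those not
    valid or not owned by [v] give the identity. *)
Lemma delta_in_G v t : v \in V0 ->
  G_subgroup e V0 c (to_out (vertex_aut (gen_delta t) v)).
Proof.
move=> vV0; have [G1 _ _] : is_subgroup (G_subgroup e V0 c) := generated_subgroup _.
have toM : {morph @to_out (raag e) : f g / f * g >-> f * g} := @to_outM _ e.
have [/andP[tV /eqP tv]|tV] := boolP (valid t && (owner t == v)); last first.
  rewrite vertex_aut1 ?(morph1 toM) // => s sV sv.
  by rewrite /gen_delta; case: eqVneq => // E; rewrite -E sV sv eqxx in tV.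
rewrite -tv; apply: sub_generated; eexists; last reflexivity.
case: t tV tv => [[u b]|[w D]] /=.
  move=> uV0 _; left; left; apply: sub_generated; exists u; split=> //.
  case: b; [left; exact/left_transvection_vertex_aut
           | right; exact/right_transvection_vertex_aut].
case/and3P => _ DC tw _; have [lf|lf] := boolP (leaf_component D); last first.
  right; apply: sub_generated; exists w, D; split=> //.
  exact/partial_conjugation_vertex_aut.
left; right; have [x xD] := components_neq0 DC; have [xw DE] := components_eq DC xD.
rewrite DE in lf; have lkx := leaf_component_lk xw lf.
have {}DE : D = [set x] by rewrite DE; apply/leaf_component_set1.
apply: sub_generated; exists x, w; split.
- by rewrite /is_leaf lkx cards1.
- by rewrite lkx finset.set11.
- by rewrite DE; apply/leaf_transvection_vertex_aut.
Qed.

Lemma Phi_in_G n : G_subgroup e V0 c (Phi n).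
Proof.
have [G1 GM GV] : is_subgroup (G_subgroup e V0 c) := generated_subgroup _.
apply: (big_ind (G_subgroup e V0 c) G1 GM) => v vV0; move: n.
have toM : {morph @to_out (raag e) : f g / f * g >-> f * g} := @to_outM _ e.
apply: int_fun_ind => [|n n' Gn Gn'|n Gn|t].
- by rewrite vertex_aut1 // (morph1 toM).
- by rewrite vertex_autD to_outM; apply: GM.
- have -> : vertex_aut (fun t => - n t)%R v = (vertex_aut n v)^-1.
    apply: (mulgI (vertex_aut n v)); rewrite -vertex_autD mulgV vertex_aut1 //.
    by move=> t _ _; rewrite subrr.
  by rewrite (morphV toM); apply: GV.
- exact: delta_in_G.
Qed.

(** * Pivots, the rank and freeness *)

(** A vertex [x] not adjacent to [v] lies in no leaf component at [v]. If its component is not a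
    twig, take that component; otherwise take the left transvection of [x]. *)
Lemma pivot_exists v : v \in V0 ->
  exists t, [&& valid t, owner t == v & rel_coef t == 1%R].
Proof.
move=> vV0; have [x [xv nvx]] := exists_nonadjacent v.
have lf : leaf_component (component v x) = false.
  by apply/negP => /(leaf_component_nbr xv); rewrite (negPf nvx).
have [tw|tw] := boolP (twig e v (component v x)); last first.
  exists (inr (v, component v x)).
  by rewrite /= vV0 component_components // tw lf !eqxx.
have [xV0 cx] := twig_chosen vV0 xv nvx tw.
by exists (inl (x, true)); rewrite /= cx xV0 tw !eqxx.
Qed.

Definition pivot v : gen_index :=
  odflt (inl (v, true)) [pick t | [&& valid t, owner t == v & rel_coef t == 1%R]].

Lemma pivotP v : v \in V0 ->
  [/\ valid (pivot v), owner (pivot v) = v & rel_coef (pivot v) = 1%R].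
Proof.
move=> /pivot_exists[t0 t0P]; rewrite /pivot; case: pickP => [t|/(_ t0)] /=.
  by case/and3P=> ? /eqP ? /eqP ?.
by rewrite t0P.
Qed.

Definition valid_set : {set gen_index} := [set t | valid t].
Definition pivots : {set gen_index} := [set pivot v | v in V0].
Definition basis : {set gen_index} := valid_set :\: pivots.

Lemma card_valid : #|valid_set| =
  (2 * #|~: V0| + \sum_(v in V0) #|[set D in components e v | ~~ twig e v D]|)%N.
Proof.
rewrite -sum1_card big_sumType /=; congr (_ + _)%N.
  rewrite (eq_bigl (fun p : V * bool => (p.1 \in ~: V0) && true)); last first.
    by case=> u b; rewrite !inE andbT.
  rewrite -(pair_big (fun u => u \in ~: V0) xpredT (fun _ _ => 1%N)) /=.
  by rewrite (eq_bigr (fun=> 2)) => [|u _];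
    rewrite sum_nat_const ?card_bool // mulnC.
rewrite (eq_bigl (fun p : V * {set V} => (p.1 \in V0) &&
    (p.2 \in [set D in components e p.1 | ~~ twig e p.1 D]))); last first.
  by case=> v D; rewrite !inE.
rewrite -(pair_big_dep (fun v => v \in V0)
  (fun v D => D \in [set D in components e v | ~~ twig e v D]) (fun _ _ => 1%N)) /=.
by apply: eq_bigr => v _; rewrite sum1_card.
Qed.

Lemma card_pivots : #|pivots| = #|V0|.
Proof.
apply: card_in_imset => v w /pivotP[_ ov _] /pivotP[_ ow _] E.
by rewrite -ov -ow E.
Qed.

(** Each [v] in [V0] contributes its components that are not twigs, minus one pivot. A summand is -1
    if all components at [v] are twigs, hence the integers. *)
Lemma card_basis : (#|basis|%:Z = 2 * #|~: V0|%:Z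
  + \sum_(v in V0) ((delta_C e v)%:Z - (tau e v)%:Z - 1))%R.
Proof.
have sub : pivots \subset valid_set.
  by apply/fintype.subsetP => _ /imsetP[v /pivotP[vv _ _] ->]; rewrite inE.
have le := subset_leq_card sub.
rewrite /basis cardsD (finset.setIidPr sub) -subzn // card_pivots card_valid.
rewrite PoszD PoszM -addrA; congr (_ + _)%R.
rewrite sumrB sumr_const; congr (_ - _)%R; last by rewrite -natz.
rewrite -natz natr_sum; apply: eq_bigr => v _.
rewrite natz /delta_C /tau -(cardsID [set D | twig e v D] (components e v)).
rewrite PoszD; have -> : components e v :&: [set D | twig e v D] =
    [set D in components e v | twig e v D] by apply/setP => D; rewrite !inE.
rewrite addrAC subrr add0r; congr (Posz #|pred_of_set _|).
by apply/setP => D; rewrite !inE andbC.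
Qed.

(** Evaluating the relation at a pivot, where [n] is 0 and the coefficient is 1, gives [k = 0] at
    its owner. *)
Lemma basis_independent n : (forall t, t \notin basis -> n t = 0%R) ->
  Phi n = 1 -> forall t, n t = 0%R.
Proof.
move=> n0 /Phi_inj[k nk] t; have [tB|/n0 //] := boolP (t \in basis).
have /andP[_ tV] : (t \notin pivots) && valid t by move: tB; rewrite !inE.
rewrite nk //; have oV0 : owner t \in V0.
  by case: t tV {tB} => [[u b] uV0|[v D] /and3P[]//]; have [] := cP uV0.
have [vp op rp] := pivotP oV0.
have pB : pivot (owner t) \notin basis.
  by rewrite !inE negb_and negbK (imset_f pivot oV0).
by have := nk _ vp; rewrite n0 // op rp mulr1 => <-; rewrite mul0r.
Qed.

Lemma Phi_basis n :
  exists n', (forall t, t \notin basis -> n' t = 0%R) /\ Phi n' = Phi n.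
Proof.
(* Subtracting this multiple of each relation clears the pivots. *)
pose k v := n (pivot v).
pose n1 t := (n t + - (k (owner t) * rel_coef t))%R.
have E1 : Phi n1 = Phi n by rewrite PhiD PhiN Phi_rel invg1 mulg1.
exists (fun t => if valid t then n1 t else 0%R); split.
  move=> t; rewrite !inE negb_and negbK => /orP[|/negPf -> //].
  case/imsetP => v vV0 ->; have [-> op rp] := pivotP vV0.
  by rewrite /n1 op rp mulr1 subrr.
rewrite -E1; apply: eq_bigr => v vV0; congr to_out.
pose n2 t := if valid t then 0%R else n1 t.
have n1E : n1 = (fun t => (if valid t then n1 t else 0) + n2 t)%R.
  by apply/funext => t; rewrite /n2; case: ifP; rewrite ?addr0 ?add0r.
rewrite [in RHS]n1E vertex_autD (@vertex_aut1 n2) ?mulg1 // => t.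
by rewrite /n2 => ->.
Qed.

Lemma G_free_abelian : free_abelian_of_rank (G_subgroup e V0 c) #|basis|.
Proof.
pose ext (a : 'rV[int]_#|basis|) : gen_index -> int :=
  fun t => (\sum_i a ord0 i * (enum_val i == t)%:Z)%R.
have ext0 a t : t \notin basis -> ext a t = 0%R.
  move=> tB; apply: big1 => i _; case: eqVneq => [E|_]; last by rewrite mulr0.
  by rewrite -E enum_valP in tB.
have extE a i : ext a (enum_val i) = a ord0 i.
  rewrite /ext (bigD1 i) //= eqxx mulr1 big1 ?addr0 // => j ji.
  by rewrite (inj_eq enum_val_inj) (negPf ji) mulr0.
have extD a b : ext (a + b)%R = fun t => (ext a t + ext b t)%R.
  apply/funext => t; rewrite /ext -big_split; apply: eq_bigr => i _.
  by rewrite mxE mulrDl.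
have PhiM : {morph (fun a => Phi (ext a)) : a b / (a + b)%R >-> a * b}.
  by move=> a b; rewrite extD PhiD.
exists (fun a => Phi (ext a)); split=> //.
- move=> a b ab; suff E : (a - b)%R = 0%R by rewrite -[a](subrK b) E add0r.
  have P1 : Phi (ext (a - b)%R) = 1.
    by apply: (mulIg (Phi (ext b))); rewrite -PhiM subrK ab mul1g.
  apply/rowP => i; rewrite -extE mxE.
  exact: (basis_independent (ext0 _) P1).
- apply/seteqP; split=> [_ [a _ <-]|g /G_in_range[n0 <-]]; first exact: Phi_in_G.
  have [n [nB <-]] := Phi_basis n0.
  exists (\row_i n (enum_val i))%R => //; congr Phi; apply/funext => t.
  have [tB|tB] := boolP (t \in basis); last by rewrite ext0 ?nB.
  by rewrite -(enum_rankK_in tB tB) extE mxE.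
Qed.

End Graph.

Theorem theorem7p4 (V : finType) (e : rel V)
    (e_sym : symmetric e) (e_irr : irreflexive e)
    (e_conn : connected_graph e) (e_tf : triangle_free e)
    (e_edges : (2 <= #|edges e|)%N) (e_nstar : ~ is_star e)
    (V0 : {set V}) (V0P : is_V0 e V0)
    (c : V -> V) (cP : forall v, v \notin V0 -> c v \in V0 /\ vle e v (c v)) :
  exists r : nat,
    (r%:Z = 2 * #|~: V0|%:Z
            + \sum_(v in V0) ((delta_C e v)%:Z - (tau e v)%:Z - 1))%R /\
    free_abelian_of_rank (G_subgroup e V0 c) r.
Proof.
exists #|basis e V0 c|; split; first exact: card_basis.
exact: G_free_abelian.
Qed.
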